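(* Let $r\in\mathbb{N}=\{1,2,3,\dots\}$ and put $$I_r=\Bigl[\tfrac{2^{r+1}}{2^{r+1}-1}\pi,\ 2\pi\Bigr],\qquad J_r=\Bigl[2^{r+1}\pi,\ \tfrac{2^{2r+2}}{2^{r+1}-1}\pi\Bigr].$$ (One has $2^{-1}I_r+2^{r+1}\pi\subset J_r$.) Let $\psi_r\in L^2(\mathbb{R})$ be the function whose Fourier transform is $$\hat\psi_r(\xi)=\begin{cases}\frac{1}{\sqrt2} & \text{if } \xi\in I_r\cup(2^{-1}I_r)\cup(2^{-1}I_r+2^{r+1}\pi),\\ -\frac{1}{\sqrt2} & \text{if } \xi\in I_r+2^{r+2}\pi,\\ 1 & \text{if } \xi\in J_r\setminus(2^{-1}I_r+2^{r+1}\pi),\\ 0 & \text{otherwise.}\end{cases}$$ Then for each $r\in\mathbb{N}$, $\psi_r$ is a wavelet for the Hardy space $H^2(\mathbb{R})$.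
   Context: The Fourier transform is $\hat f(\xi)=\int_{\mathbb{R}} f(x)e^{-i\xi x}\,dx$ (extended to $L^2(\mathbb{R})$ as usual). The Hardy space is $H^2(\mathbb{R})=\{f\in L^2(\mathbb{R}):\hat f(\xi)=0\text{ for a.e. }\xi\le 0\}$, a closed subspace of $L^2(\mathbb{R})$. A function $\psi\in H^2(\mathbb{R})$ is a wavelet for $H^2(\mathbb{R})$ (an $H^2$-wavelet) if $\{\psi_{j,k}=2^{j/2}\psi(2^j\cdot-k):j,k\in\mathbb{Z}\}$ is an orthonormal basis of $H^2(\mathbb{R})$. For a set $S\subset\mathbb{R}$ and reals $c,a$, $cS+a=\{cs+a:s\in S\}$. *)

(* Defs.v *)
From HB Require Import structures.
From mathcomp Require Import all_boot all_order all_algebra.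
From mathcomp Require Import all_classical all_reals all_analysis.
From mathcomp Require Import complex ring lra.

Set Implicit Arguments.
Unset Strict Implicit.
Unset Printing Implicit Defensive.
Import Order.TTheory GRing.Theory Num.Theory.
Import numFieldNormedType.Exports.
Local Open Scope classical_set_scope.
Local Open Scope ring_scope.
Local Open Scope complex_scope.

Section ComplexL2.
Context {R : realType}.
Implicit Types (f g : R -> R[i]) (p : \bar R).

Local Notation mu := (@lebesgue_measure R).

(* The library's [Lnorm] and integral are for real-valued functions only. *)
Definition cLnorm p f : \bar R :=
  Lnorm mu p (fun x => (Normc.normc (f x))%:E).

(* Functions, not classes: equality in L^p is [cLnorm p (f - g) = 0]. *)
Definition cLfun p : set (R -> R[i]) :=
  [set f : R -> R[i] |
     [/\ measurable_fun [set: R] (fun x : R => complex.Re (f x) : R),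
         measurable_fun [set: R] (fun x : R => complex.Im (f x) : R) &
         (cLnorm p f < +oo)%E]].

Definition cintegral f : R[i] :=
  (\int[mu]_x complex.Re (f x)) +i* (\int[mu]_x complex.Im (f x)).

Definition dotL2 f g : R[i] := cintegral (fun x => f x * conjc (g x)).

Definition cvgL2 (u : nat -> R -> R[i]) f : Prop :=
  cLnorm 2%:E (fun x => u n x - f x) @[n --> \oo] --> 0%E.

(* exp (i t) *)
Definition cis (t : R) : R[i] := cos t +i* sin t.

Definition fourier1 f : R -> R[i] :=
  fun xi => cintegral (fun x => f x * cis (- (xi * x))).

(* [g] represents the Fourier transform of [f] in L^2: the graph of the
   continuous extension to L^2 is the closure in L^2 x L^2 of the graph of
   [fourier1] on L^1 `&` L^2. *)
Definition is_fourier f g : Prop :=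
  [/\ cLfun 2%:E f, cLfun 2%:E g &
      exists u : nat -> R -> R[i],
        [/\ forall n, (cLfun 1%:E `&` cLfun 2%:E) (u n),
            cvgL2 u f &
            cvgL2 (fun n => fourier1 (u n)) g]].

Definition hardy2 : set (R -> R[i]) :=
  [set f | cLfun 2%:E f /\
     exists2 g, is_fourier f g & {ae mu, forall xi, xi <= 0 -> g xi = 0}].

(* Orthonormal basis in the Hilbert space sense: an orthonormal family in [H]
   whose finite linear combinations are dense in [H]. *)
Definition orthonormal_basis (I : eqType) (H : set (R -> R[i]))
    (e : I -> R -> R[i]) : Prop :=
  [/\ forall i, H (e i),
      forall i j, dotL2 (e i) (e j) = (i == j)%:R &
      forall f, H f -> forall eps : R, 0 < eps ->
        exists (s : seq I) (c : I -> R[i]),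
          (cLnorm 2%:E (fun x => (f x - \sum_(i <- s) c i * e i x)%R)
             < eps%:E)%E].

Definition dyadic f (jk : int * int) : R -> R[i] :=
  fun x => (2 `^ (jk.1%:~R / 2))%:C * f (2 ^ jk.1 * x - jk.2%:~R).

Definition H2_wavelet f : Prop :=
  hardy2 f /\ orthonormal_basis hardy2 (dyadic f).

End ComplexL2.

Section PsiHat.
Context {R : realType}.

Definition affset (c : R) (S : set R) (a : R) : set R :=
  [set c * s + a | s in S].

Definition I_ (r : nat) : set R :=
  `[2 ^+ r.+1 / (2 ^+ r.+1 - 1) * pi, 2 * pi].

Definition J_ (r : nat) : set R :=
  `[2 ^+ r.+1 * pi, 2 ^+ (2 * r + 2) / (2 ^+ r.+1 - 1) * pi].

Lemma halfI_subset_J (r : nat) : (1 <= r)%N ->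
  affset 2^-1 (I_ r) (2 ^+ r.+1 * pi) `<=` J_ r.
Proof.
move=> r1 _ [s /= + <-]; rewrite /I_ /J_ /= !in_itv /= => /andP[sl su].
have -> : (2 * r + 2 = r.+1 + r.+1)%N by rewrite mul2n -addnn addn2 addSn addnS.
rewrite exprD; set t : R := 2 ^+ r.+1 in sl *.
have t2 : 2 <= t by rewrite /t exprS ler_peMr// exprn_ege1// ler1n.
have p0 := pi_gt0 R.
have s0 : 0 <= s.
  by apply: le_trans sl; rewrite mulr_ge0 ?divr_ge0 ?(ltW p0)//; lra.
apply/andP; split; first by lra.
have -> : t * t / (t - 1) * pi = t * pi + pi + pi / (t - 1).
  by field; apply/eqP; lra.
have : 0 <= pi / (t - 1) by rewrite divr_ge0 ?(ltW p0)//; lra.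
lra.
Qed.

Definition psi_hat (r : nat) (xi : R) : R[i] :=
  if xi \in I_ r `|` affset 2^-1 (I_ r) 0
              `|` affset 2^-1 (I_ r) (2 ^+ r.+1 * pi)
    then ((Num.sqrt 2)^-1)%:C
  else if xi \in affset 1 (I_ r) (2 ^+ r.+2 * pi)
    then (- (Num.sqrt 2)^-1)%:C
  else if xi \in J_ r `\` affset 2^-1 (I_ r) (2 ^+ r.+1 * pi)
    then 1
  else 0.

End PsiHat.

(* Main.v *)
From HB Require Import structures.
Require Import Defs.
From mathcomp Require Import all_boot all_order all_algebra.
From mathcomp Require Import all_classical all_reals all_analysis.
From mathcomp Require Import measurable_realfun.
From mathcomp Require Import complex zify ring lra.

(** Put A = 2^(r+1) and Q = A pi, and let al satisfy 2 al A = Q + 2 al, so that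
    pi/2 < al < pi, I_r = [2 al, 2 pi] and J_r = [Q, Q + 2 al]. The Fourier transform
    of psi is then, off finitely many points, the [profile]: with s = 1 / sqrt 2,
    - s on ]al, pi] and on ]Q + al, Q + pi],
    - s on ]2 al, 2 pi] and -s on ]2 Q + 2 al, 2 Q + 2 pi],
    - 1 on ]Q, Q + al] and on ]Q + pi, Q + 2 al].

    By the Plancherel theorem the problem may be solved on the Fourier side. There
    the dyadic translates and dilates of psi become the dyadic dilates of the
    functions profile(x) cis(-k x), and the Hardy space becomes the space of the
    functions that vanish on the negative half-line.

    Orthonormality. Q and 2 Q are multiples of 2 pi. Modulo 2 pi the squared profile
    has total weight 1 at each point: either a single 1 or 1/2 + 1/2; so
    at one scale the family is as orthonormal as the characters of the circle
    ([dot_modulated]). Between adjacent scales the product profile(x) profile(x/2)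
    is 1/2 on I_r, -1/2 on I_r + 2 Q and 0 elsewhere; the two contributions cancel because 2 Q is a
    multiple of 4 pi. At greater distance the supports are disjoint
    ([dot_modulated_dil]).

    Completeness. Let M be the closed span. Trigonometric polynomials approximate
    the indicators of arcs of the circle, so M contains the restriction of the
    profile to all the fibres y + 2 pi Z above an arc ([cs_arc], [cs_fiber]). If only
    one point of the fibre lies in the support, this is a multiple of the indicator
    of an interval. Otherwise it is, up to the factor s, 1_E - 1_(E + 2 Q) for E in I_r or
    1_(E / 2) + 1_(E / 2 + Q), whose dilate by 2 is proportional to 1_E + 1_(E + 2 Q);
    hence 1_E and 1_(E + 2 Q) both lie in M ([M_I]). The intervals obtained in this way, with their dyadic
    dilates, cover the octave ]Q, 2 Q] ([fills_octave]); the dilates of an octave fill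
    the half-line ([wavelets_complete]).

    Plancherel. The Fourier transform on L^2 is given as the closure of the graph of
    the Fourier integral, so it has to be shown isometric up to the factor 2 pi. For
    a function supported in ]0, 2 pi] the values of the Fourier integral along t + Z
    are the Fourier coefficients of a modulation, and Parseval's identity, integrated
    over t in ]0, 1], is Plancherel's ([Plancherel_circle]). Dilations and truncation
    give the general case ([Plancherel]). Parseval's identity rests on the same
    approximation of arcs by trigonometric polynomials. *)

Set Implicit Arguments.
Unset Strict Implicit.
Unset Printing Implicit Defensive.
Import Order.TTheory GRing.Theory Num.Theory.
Import numFieldNormedType.Exports.
Local Open Scope classical_set_scope.
Local Open Scope ring_scope.
Local Open Scope complex_scope.

(** * Square-integrable complex functions *)

Section Basics.
Context {R : realType}.
Implicit Types (f g h : R -> R[i]) (z w : R[i]).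
Local Notation mu := (@lebesgue_measure R).
Local Notation Re := (@complex.Re R).
Local Notation Im := (@complex.Im R).

(** The squared modulus as a polynomial in the real and imaginary parts: unlike
    the modulus it is accessible to [ring] and [lra]. *)
Definition sqn z : R := Re z ^+ 2 + Im z ^+ 2.

Lemma ReD z w : Re (z + w) = Re z + Re w. Proof. by case: z; case: w. Qed.
Lemma ImD z w : Im (z + w) = Im z + Im w. Proof. by case: z; case: w. Qed.
Lemma ReN z : Re (- z) = - Re z. Proof. by case: z. Qed.
Lemma ImN z : Im (- z) = - Im z. Proof. by case: z. Qed.
Lemma ReM z w : Re (z * w) = Re z * Re w - Im z * Im w.
Proof. by case: z; case: w. Qed.
Lemma ImM z w : Im (z * w) = Re z * Im w + Im z * Re w.
Proof. by case: z; case: w. Qed.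
Lemma ReJ z : Re (conjc z) = Re z. Proof. by case: z. Qed.
Lemma ImJ z : Im (conjc z) = - Im z. Proof. by case: z. Qed.
Definition ReImE := (ReD, ImD, ReN, ImN, ReM, ImM, ReJ, ImJ).

Lemma complex_ext z w : Re z = Re w -> Im z = Im w -> z = w.
Proof. by case: z => a b; case: w => c d /= -> ->. Qed.

Lemma conjM z w : conjc (z * w) = conjc z * conjc w.
Proof. by apply: complex_ext; rewrite !ReImE; ring. Qed.

Lemma sqn_ge0 z : 0 <= sqn z. Proof. by rewrite addr_ge0 ?sqr_ge0. Qed.
Lemma sqnM z w : sqn (z * w) = sqn z * sqn w.
Proof. by rewrite /sqn !ReImE; ring. Qed.
Lemma sqnN z : sqn (- z) = sqn z.
Proof. by rewrite /sqn !ReImE; ring. Qed.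

Lemma sqn0 : sqn 0 = 0. Proof. by rewrite /sqn /= expr0n addr0. Qed.
Lemma sqn_real (a : R) : sqn a%:C = a ^+ 2.
Proof. by rewrite /sqn /= expr0n addr0. Qed.
Lemma sqn_cis (t : R) : sqn (cis t) = 1. Proof. exact: cos2Dsin2. Qed.

Lemma sqnD_le z w : sqn (z + w) <= 2 * (sqn z + sqn w).
Proof.
rewrite /sqn !ReImE -subr_ge0 [leRHS](_ : _ = (Re z - Re w) ^+ 2 + (Im z - Im w) ^+ 2).
  by rewrite addr_ge0 ?sqr_ge0.
by ring.
Qed.
Lemma sqnB_le z w : sqn (z - w) <= 2 * (sqn z + sqn w).
Proof. by rewrite -(sqnN w); exact: sqnD_le. Qed.
Lemma Re_le_sqn z w : `|Re (z * conjc w)| <= sqn z + sqn w.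
Proof.
rewrite ler_norml /sqn !ReImE; apply/andP; split.
- have := sqr_ge0 (Re z + Re w); have := sqr_ge0 (Im z + Im w).
  have := sqr_ge0 (Re z); have := sqr_ge0 (Im z); have := sqr_ge0 (Re w); have := sqr_ge0 (Im w).
  by nra.
- have := sqr_ge0 (Re z - Re w); have := sqr_ge0 (Im z - Im w).
  have := sqr_ge0 (Re z); have := sqr_ge0 (Im z); have := sqr_ge0 (Re w); have := sqr_ge0 (Im w).
  by nra.
Qed.
Lemma Im_le_sqn z w : `|Im (z * conjc w)| <= sqn z + sqn w.
Proof.
have -> : Im (z * conjc w) = Re (z * conjc ('i%C * w)).
  by rewrite !ReImE /=; ring.
by apply: (le_trans (Re_le_sqn _ _)); rewrite sqnM /sqn/= expr0n expr1n add0r mul1r.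
Qed.

Definition cmeas f : Prop :=
  measurable_fun [set: R] (fun x => Re (f x)) /\
  measurable_fun [set: R] (fun x => Im (f x)).

Lemma cmeasD f g : cmeas f -> cmeas g -> cmeas (fun x => f x + g x).
Proof.
move=> [f1 f2] [g1 g2]; split.
  by under eq_fun do rewrite ReD; exact: measurable_funD.
by under eq_fun do rewrite ImD; exact: measurable_funD.
Qed.

Lemma cmeasM f g : cmeas f -> cmeas g -> cmeas (fun x => f x * g x).
Proof.
move=> [f1 f2] [g1 g2]; split.
  by under eq_fun do rewrite ReM; apply: measurable_funB; exact: measurable_funM.
by under eq_fun do rewrite ImM; apply: measurable_funD; exact: measurable_funM.
Qed.

Lemma cmeasJ f : cmeas f -> cmeas (fun x => conjc (f x)).
Proof.
move=> [f1 f2]; split; first by under eq_fun do rewrite ReJ.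
by under eq_fun do rewrite ImJ; exact: measurableT_comp.
Qed.

Lemma cmeas_cst z : cmeas (fun=> z).
Proof. by split; exact: measurable_cst. Qed.

Lemma cmeasN f : cmeas f -> cmeas (fun x => - f x).
Proof.
move=> mf; rewrite (_ : (fun x => _) = fun x => (-1) * f x); last first.
  by apply/funext => x; rewrite mulN1r.
exact/cmeasM/mf/cmeas_cst.
Qed.

Lemma cmeasB f g : cmeas f -> cmeas g -> cmeas (fun x => f x - g x).
Proof. by move=> mf mg; exact/cmeasD/cmeasN. Qed.

Lemma cmeas_real (a : R -> R) : measurable_fun [set: R] a ->
  cmeas (fun x => (a x)%:C).
Proof. by move=> ma; split => //=; exact: measurable_cst. Qed.

Lemma cmeas_comp f (a : R -> R) : measurable_fun [set: R] a ->
  cmeas f -> cmeas (fun x => f (a x)).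
Proof.
move=> ma [f1 f2]; split.
  exact: (measurableT_comp f1 ma).
exact: (measurableT_comp f2 ma).
Qed.

Lemma cmeas_cis : cmeas cis.
Proof.
split.
  by apply: continuous_measurable_fun; exact: continuous_cos.
by apply: continuous_measurable_fun; exact: continuous_sin.
Qed.

Lemma measurable_sqn f : cmeas f -> measurable_fun [set: R] (fun x => sqn (f x)).
Proof.
by move=> [f1 f2]; apply: measurable_funD; exact: measurable_funX.
Qed.

Definition cintegrable f : Prop :=
  mu.-integrable [set: R] (fun x => (Re (f x))%:E) /\
  mu.-integrable [set: R] (fun x => (Im (f x))%:E).

(** The squared L^2 norm as a real number, which agrees with the extended norm
    only on L^2 ([cLnormE]). *)
Definition N2 f : R := \int[mu]_x sqn (f x).
Definition L2 f : Prop := cLfun 2%:E f.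

Lemma normc_sq z : Normc.normc z ^+ 2 = sqn z.
Proof. by case: z => a b; rewrite /= sqr_sqrtr// addr_ge0 ?sqr_ge0. Qed.

Lemma cLnorm2E f : cLnorm 2%:E f = ((\int[mu]_x (sqn (f x))%:E) `^ 2^-1)%E.
Proof.
rewrite /cLnorm unlock; congr (_ `^ _)%E; apply: eq_integral => x _.
rewrite /= ger0_norm ?poweR_EFin; last by case: (f x) => a b; exact: sqrtr_ge0.
rewrite -[2]/(2%:R) powR_mulrn ?normc_sq//.
by case: (f x) => a b; exact: sqrtr_ge0.
Qed.

Lemma L2P f : L2 f <->
  cmeas f /\ mu.-integrable [set: R] (fun x => (sqn (f x))%:E).
Proof.
have absE : (\int[mu]_x `|(sqn (f x))%:E| = \int[mu]_x (sqn (f x))%:E)%E.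
  by apply: eq_integral => x _; rewrite gee0_abs// lee_fin sqn_ge0.
split.
  move=> [f1 f2]; rewrite cLnorm2E => fin; split => //.
  apply/integrableP; split.
    by apply/measurable_EFinP; exact: measurable_sqn.
  rewrite absE ltNge leye_eq; apply/negP => /eqP fi.
  by move: fin; rewrite fi poweRyr ?ltxx// invr_neq0.
move=> [[f1 f2] /integrableP[_]]; rewrite absE => fin; split => //.
by rewrite cLnorm2E poweR_lty.
Qed.

Lemma N2_ge0 f : 0 <= N2 f.
Proof. by apply: Rintegral_ge0 => x _; exact: sqn_ge0. Qed.

Lemma N2E f : L2 f -> (\int[mu]_x (sqn (f x))%:E)%E = (N2 f)%:E.
Proof.
by move=> /L2P[_ intf]; rewrite /N2 /Rintegral fineK//; exact: integrable_fin_num.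
Qed.

Lemma cLnormE f : L2 f -> cLnorm 2%:E f = (Num.sqrt (N2 f))%:E.
Proof.
by move=> f2; rewrite cLnorm2E N2E// poweR_EFin powR12_sqrt// N2_ge0.
Qed.

Lemma cintegrable_meas f : cintegrable f -> cmeas f.
Proof.
by move=> [/measurable_int/measurable_EFinP ? /measurable_int/measurable_EFinP ?]; split.
Qed.

Lemma integrable_dom (a b : R -> R) : measurable_fun [set: R] a ->
  mu.-integrable [set: R] (EFin \o b) -> (forall x, `|a x| <= b x) ->
  mu.-integrable [set: R] (EFin \o a).
Proof.
move=> ma ib ab; apply: (le_integrable measurableT _ _ ib).
  exact/measurable_EFinP.
by move=> x _; rewrite /= lee_fin (le_trans (ab x))// ler_norm.
Qed.

Lemma cintegrable_dom f (b : R -> R) : cmeas f ->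
  mu.-integrable [set: R] (EFin \o b) ->
  (forall x, `|Re (f x)| <= b x) -> (forall x, `|Im (f x)| <= b x) ->
  cintegrable f.
Proof. by move=> [f1 f2] ib *; split; apply: integrable_dom ib _. Qed.

Lemma cintegrableD f g : cintegrable f -> cintegrable g ->
  cintegrable (fun x => f x + g x).
Proof.
move=> [f1 f2] [g1 g2]; split.
  rewrite (_ : (fun x => _) = (fun x => (Re (f x))%:E + (Re (g x))%:E)%E).
    exact: integrableD.
  by apply/funext => x; rewrite ReD EFinD.
rewrite (_ : (fun x => _) = (fun x => (Im (f x))%:E + (Im (g x))%:E)%E).
  exact: integrableD.
by apply/funext => x; rewrite ImD EFinD.
Qed.

Lemma cintegralD f g : cintegrable f -> cintegrable g ->
  cintegral (fun x => f x + g x) = cintegral f + cintegral g.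
Proof.
move=> [f1 f2] [g1 g2]; apply: complex_ext; rewrite !ReImE /=.
  by under eq_Rintegral do rewrite ReD; rewrite RintegralD.
by under eq_Rintegral do rewrite ImD; rewrite RintegralD.
Qed.

Lemma integrableMl (c : R) (a : R -> R) : mu.-integrable [set: R] (EFin \o a) ->
  mu.-integrable [set: R] (EFin \o (fun x => c * a x)).
Proof. by move=> ia; exact: (integrableZl measurableT c ia). Qed.

Lemma integrableDr (a b : R -> R) : mu.-integrable [set: R] (EFin \o a) ->
  mu.-integrable [set: R] (EFin \o b) ->
  mu.-integrable [set: R] (EFin \o (fun x => a x + b x)).
Proof. by move=> ia ib; exact: (integrableD measurableT ia ib). Qed.

Lemma cintegrableZ c f : cintegrable f -> cintegrable (fun x => c * f x).
Proof.
move=> [f1 f2]; split.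
  under eq_fun do rewrite ReM -mulNr.
  by apply: integrableDr; exact: integrableMl.
under eq_fun do rewrite ImM.
by apply: integrableDr; exact: integrableMl.
Qed.

Lemma cintegralZ c f : cintegrable f ->
  cintegral (fun x => c * f x) = c * cintegral f.
Proof.
move=> [f1 f2]; apply: complex_ext; rewrite !ReImE /=.
  under eq_Rintegral do rewrite ReM -mulNr.
  by rewrite RintegralD ?RintegralZl ?mulNr//; exact: integrableMl.
under eq_Rintegral do rewrite ImM.
by rewrite RintegralD ?RintegralZl//; exact: integrableMl.
Qed.

Lemma cintegralJ f : cintegrable f ->
  cintegral (fun x => conjc (f x)) = conjc (cintegral f).
Proof.
move=> [f1 f2]; apply: complex_ext; rewrite !ReImE /=.
  by apply: eq_Rintegral => x _; rewrite ReJ.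
under eq_Rintegral do rewrite ImJ -mulN1r.
by rewrite RintegralZl// mulN1r.
Qed.

Lemma L2_meas f : L2 f -> cmeas f. Proof. by move=> /L2P[]. Qed.

Lemma L2_dom f g (K : R) : cmeas f -> L2 g ->
  (forall x, sqn (f x) <= K * sqn (g x)) -> L2 f.
Proof.
move=> mf /L2P[mg ig] fg; apply/L2P; split => //.
apply: (integrable_dom (b := fun x => K * sqn (g x))).
- exact: measurable_sqn.
- exact: integrableMl.
- by move=> x; rewrite ger0_norm ?sqn_ge0.
Qed.

Lemma L2D f g : L2 f -> L2 g -> L2 (fun x => f x + g x).
Proof.
move=> /L2P[mf ig] /L2P[mg jg]; apply/L2P; split; first exact: cmeasD.
apply: (integrable_dom (b := fun x => 2 * (sqn (f x) + sqn (g x)))).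
- by apply: measurable_sqn; exact: cmeasD.
- exact/integrableMl/integrableDr.
- by move=> x; rewrite ger0_norm ?sqn_ge0// sqnD_le.
Qed.

Lemma L2Mb m f (K : R) : cmeas m -> (forall x, sqn (m x) <= K) -> L2 f ->
  L2 (fun x => m x * f x).
Proof.
move=> mm mK f2; apply: (L2_dom (K := K) _ f2).
  exact/cmeasM/L2_meas.
by move=> x; rewrite sqnM ler_wpM2r ?sqn_ge0.
Qed.

Lemma L2Z c f : L2 f -> L2 (fun x => c * f x).
Proof. by move=> f2; apply: (L2Mb (m := fun=> c) (K := sqn c)) => //; exact: cmeas_cst. Qed.

Lemma L2N f : L2 f -> L2 (fun x => - f x).
Proof.
move=> f2; rewrite (_ : (fun x => _) = fun x => (-1) * f x); first exact: L2Z.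
by apply/funext => x; rewrite mulN1r.
Qed.

Lemma L2B f g : L2 f -> L2 g -> L2 (fun x => f x - g x).
Proof. by move=> f2 g2; apply: L2D => //; exact: L2N. Qed.

Lemma L2_0 : L2 (fun=> 0).
Proof.
apply/L2P; split; first exact: cmeas_cst.
by under eq_fun do rewrite sqn0; exact: integrable0.
Qed.

Lemma L2_sum (I : Type) (s : seq I) (F : I -> R -> R[i]) :
  (forall i, L2 (F i)) -> L2 (fun x => \sum_(i <- s) F i x).
Proof.
move=> mF; elim: s => [|i s IH].
  by under eq_fun do rewrite big_nil; exact: L2_0.
by under eq_fun do rewrite big_cons; exact: L2D.
Qed.

Lemma cintegrable_dot f g : L2 f -> L2 g -> cintegrable (fun x => f x * conjc (g x)).
Proof.
move=> /L2P[mf ig] /L2P[mg jg].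
apply: (cintegrable_dom (b := fun x => sqn (f x) + sqn (g x))).
- exact/cmeasM/cmeasJ.
- exact: integrableDr.
- by move=> x; exact: Re_le_sqn.
- by move=> x; exact: Im_le_sqn.
Qed.

Lemma mulcJ z : z * conjc z = (sqn z)%:C.
Proof. by apply: complex_ext; rewrite /sqn !ReImE /=; ring. Qed.

Lemma dotE f : dotL2 f f = (N2 f)%:C.
Proof.
rewrite /dotL2; under eq_fun do rewrite mulcJ.
by rewrite /cintegral /=; congr (_ +i* _); rewrite Rintegral_cst// mul0r.
Qed.

Lemma dotDl f g h : L2 f -> L2 g -> L2 h ->
  dotL2 (fun x => f x + g x) h = dotL2 f h + dotL2 g h.
Proof.
move=> f2 g2 h2; rewrite /dotL2 -cintegralD//; try exact: cintegrable_dot.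
by congr cintegral; apply/funext => x; rewrite mulrDl.
Qed.

Lemma dotZl c f h : L2 f -> L2 h ->
  dotL2 (fun x => c * f x) h = c * dotL2 f h.
Proof.
move=> f2 h2; rewrite /dotL2 -cintegralZ//; try exact: cintegrable_dot.
by congr cintegral; apply/funext => x; rewrite mulrA.
Qed.

Lemma dotC f g : L2 f -> L2 g -> dotL2 g f = conjc (dotL2 f g).
Proof.
move=> f2 g2; rewrite /dotL2 -cintegralJ//; try exact: cintegrable_dot.
by congr cintegral; apply/funext => x; rewrite rmorphM /= conjcK mulrC.
Qed.

Lemma dotDr f g h : L2 f -> L2 g -> L2 h ->
  dotL2 h (fun x => f x + g x) = dotL2 h f + dotL2 h g.
Proof.
move=> f2 g2 h2; rewrite (dotC (L2D f2 g2) h2) dotDl// rmorphD /=.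
by rewrite (dotC f2 h2) (dotC g2 h2).
Qed.

Lemma dotZr c f h : L2 f -> L2 h ->
  dotL2 h (fun x => c * f x) = conjc c * dotL2 h f.
Proof.
by move=> f2 h2; rewrite (dotC (L2Z c f2) h2) dotZl// rmorphM /= (dotC f2 h2).
Qed.

Lemma N2D f g : L2 f -> L2 g ->
  N2 (fun x => f x + g x) = N2 f + N2 g + 2 * Re (dotL2 f g).
Proof.
move=> f2 g2; have fg := L2D f2 g2.
have : (N2 (fun x => f x + g x))%:C = (N2 f + N2 g)%:C + (dotL2 f g + conjc (dotL2 f g)).
  by rewrite -dotE dotDl ?dotDr// !dotE (dotC f2 g2) rmorphD/=; ring.
by move=> /(congr1 Re); rewrite !ReImE /= => ->; ring.
Qed.

Lemma N2Z c f : L2 f -> N2 (fun x => c * f x) = sqn c * N2 f.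
Proof.
move=> f2; apply: (congr1 Re (_ : (_)%:C = (_)%:C)).
by rewrite -dotE dotZl ?dotZr// ?dotE ?rmorphM/= -?mulcJ ?mulrA//; exact: L2Z.
Qed.

Lemma N2N f : L2 f -> N2 (fun x => - f x) = N2 f.
Proof.
move=> f2; rewrite /N2; by under eq_Rintegral do rewrite sqnN.
Qed.

Lemma Re_realM (t : R) z : Re (conjc t%:C * z) = t * Re z.
Proof. by rewrite ReM /= oppr0 mul0r subr0. Qed.

(** Only the real part is bounded, as the triangle inequality asks: N2 (f + t g)
    is a nonnegative polynomial of degree at most 2 in the real variable t. *)
Lemma CauchySchwarz f g : L2 f -> L2 g ->
  `|Re (dotL2 f g)| <= Num.sqrt (N2 f) * Num.sqrt (N2 g).
Proof.
move=> f2 g2; rewrite -sqrtrM ?N2_ge0// -sqrtr_sqr ler_sqrt ?mulr_ge0 ?N2_ge0//.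
set D := Re _; have H t : 0 <= N2 f + 2 * t * D + t ^+ 2 * N2 g.
  have := N2_ge0 (fun x => f x + t%:C * g x).
  rewrite N2D ?N2Z ?dotZr//; last exact: L2Z.
  by rewrite sqn_real Re_realM -/D => h; lra.
have g0 := N2_ge0 g.
have [N0|N0] := eqVneq (N2 g) 0.
  have [->|D0] := eqVneq D 0; first by rewrite expr0n /= mulr_ge0 ?N2_ge0.
  (* the quadratic degenerates to an affine function, negative at this point *)
  have := H (- (N2 f + 1) / (2 * D)); rewrite N0 mulr0 addr0.
  rewrite (_ : 2 * _ * D = - (N2 f + 1)); first by lra.
  by field.
have := H (- D / N2 g); rewrite (_ : _ + _ = N2 f - D ^+ 2 / N2 g); last by field.
by rewrite subr_ge0 ler_pdivrMr// lt0r N0.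
Qed.

Definition nrm f := Num.sqrt (N2 f).
Lemma nrm_ge0 f : 0 <= nrm f. Proof. exact: sqrtr_ge0. Qed.
Lemma nrm_sqr f : nrm f ^+ 2 = N2 f. Proof. by rewrite sqr_sqrtr// N2_ge0. Qed.

Lemma nrmD f g : L2 f -> L2 g -> nrm (fun x => f x + g x) <= nrm f + nrm g.
Proof.
move=> f2 g2; rewrite -(@ler_pXn2r _ 2)// ?nnegrE ?addr_ge0 ?nrm_ge0//.
rewrite nrm_sqr N2D// sqrrD !nrm_sqr.
have := CauchySchwarz f2 g2; rewrite ler_norml => /andP[_].
by rewrite -/(nrm f) -/(nrm g); lra.
Qed.

Lemma nrmN f : L2 f -> nrm (fun x => - f x) = nrm f.
Proof. by move=> f2; rewrite /nrm N2N. Qed.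

Lemma nrm_dist f g : L2 f -> L2 g -> `|nrm f - nrm g| <= nrm (fun x => f x - g x).
Proof.
move=> f2 g2; rewrite ler_norml; apply/andP; split.
  have := nrmD f2 (L2N (L2B f2 g2)); rewrite nrmN; last exact: L2B.
  rewrite (_ : (fun x => _) = g); first by lra.
  by apply/funext => x; ring.
have := nrmD g2 (L2B f2 g2).
rewrite (_ : (fun x => _) = f); first by lra.
by apply/funext => x; ring.
Qed.

Lemma N2D_le f g : L2 f -> L2 g -> N2 (fun x => f x + g x) <= 2 * (N2 f + N2 g).
Proof.
move=> f2 g2; have := N2_ge0 (fun x => f x - g x).
rewrite (N2D f2 (L2N g2)) N2D// N2N//.
have -> : (fun x => - g x) = fun x => (-1)%:C * g x.
  by apply/funext => x; rewrite rmorphN1 mulN1r.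
by rewrite dotZr// Re_realM; lra.
Qed.

Lemma aeS (P Q : R -> Prop) : (forall x, P x -> Q x) ->
  {ae mu, forall x, P x} -> {ae mu, forall x, Q x}.
Proof. by move=> PQ; apply: negligibleS => x /= nQ /PQ. Qed.

Lemma ae_eq_N2 f g : L2 f -> cmeas g -> {ae mu, forall x, f x = g x} ->
  L2 g /\ N2 (fun x => f x - g x) = 0.
Proof.
move=> f2 mg fg.
have mfg : cmeas (fun x => f x - g x) by apply: cmeasB => //; exact: L2_meas.
have mE : measurable_fun [set: R] (fun x => (sqn (f x - g x))%:E).
  by apply/measurable_EFinP; exact: measurable_sqn.
have z : (\int[mu]_x (sqn (f x - g x))%:E = 0)%E.
  rewrite -(@integral0 _ _ _ mu [set: R]); apply: ae_eq_integral => //.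
  by apply: aeS fg => x -> _; rewrite subrr sqn0.
have fg2 : L2 (fun x => f x - g x).
  apply/L2P; split => //; apply/integrableP; split => //.
  under eq_integral do rewrite gee0_abs ?lee_fin ?sqn_ge0//.
  by rewrite z.
split; last by rewrite /N2 /Rintegral z.
rewrite (_ : g = fun x => f x - (f x - g x)); first exact: L2B.
by apply/funext => x; ring.
Qed.

Lemma cvg_dist0 (u : nat -> R) : u n @[n --> \oo] --> (0 : R) <->
  forall e, 0 < e -> exists N, forall n, (N <= n)%N -> `|u n| < e.
Proof.
split.
  move=> /cvgrPdist_lt H e /H [N _ HN]; exists N => n Nn.
  by have := HN n Nn; rewrite /= sub0r normrN.
move=> H; apply/cvgrPdist_lt => e /H [N HN]; exists N => // n /= Nn.
by rewrite sub0r normrN; exact: HN.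
Qed.

(** The dominating function is 4 |g|^2, since |u_n - f|^2 <= 2 (|u_n|^2 + |f|^2). *)
Lemma N2_dominated (u : nat -> R -> R[i]) f g :
  L2 g -> (forall n, cmeas (u n)) -> cmeas f ->
  (forall n x, sqn (u n x) <= sqn (g x)) -> (forall x, sqn (f x) <= sqn (g x)) ->
  {ae mu, forall x, sqn (u n x - f x) @[n --> \oo] --> (0 : R)} ->
  N2 (fun x => u n x - f x) @[n --> \oo] --> (0 : R).
Proof.
move=> /L2P[mg ig] mu_ mf ug fg uf.
have := @dominated_convergence _ _ _ mu [set: R] measurableT
  (fun n x => (sqn (u n x - f x))%:E) (cst 0%E) (fun x => (4 * sqn (g x))%:E).
case.
- by move=> n; apply/measurable_EFinP; apply: measurable_sqn; exact: cmeasB.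
- exact: measurable_cst.
- by apply: aeS uf => x ux _; apply/cvg_EFin => //; exact: nearW.
- exact: (integrableMl 4 ig).
- apply: aeW => x n _; rewrite /= lee_fin ger0_norm ?sqn_ge0//.
  by have := sqnB_le (u n x) (f x); have := ug n x; have := fg x; lra.
move=> _ _; rewrite integral_cst// mul0e => /fine_cvg. by apply.
Qed.

End Basics.

(** * Closed subspaces of L^2 *)

Section ClosedSubspaces.
Context {R : realType}.
Implicit Types (f g h : R -> R[i]) (z w : R[i]).
Local Notation mu := (@lebesgue_measure R).

(** Subspaces are sets of functions rather than of classes, so closure under
    almost everywhere equality is a consequence of closure under limits
    ([cs_ae]). Lemmas with prefix [cs] are about such a subspace [M]. *)
Definition closed_subspace (M : (R -> R[i]) -> Prop) : Prop :=
  [/\ forall f, M f -> L2 f,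
      M (fun=> 0),
      forall f g, M f -> M g -> M (fun x => f x + g x),
      forall c f, M f -> M (fun x => c * f x) &
      forall (u : nat -> R -> R[i]) f, (forall n, M (u n)) -> L2 f ->
        N2 (fun x => u n x - f x) @[n --> \oo] --> (0 : R) -> M f].

Lemma N2_0 : N2 (fun=> 0 : R[i]) = 0 :> R.
Proof.
rewrite /N2; under eq_Rintegral do rewrite sqn0.
by rewrite Rintegral_cst// mul0r.
Qed.

Section Span.
Context {I : Type} (e : I -> R -> R[i]).
Hypothesis eL2 : forall i, L2 (e i).

(** Coefficients and indices are listed together, without uniqueness: such lists
    are closed under concatenation and products. *)
Definition comb (l : seq (R[i] * I)) (x : R) : R[i] :=
  \sum_(p <- l) p.1 * e p.2 x.

Definition clspan f : Prop :=
  L2 f /\ forall eps : R, 0 < eps ->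
    exists l, N2 (fun x => f x - comb l x) < eps.

Lemma L2_comb l : L2 (comb l).
Proof. by apply: L2_sum => p; exact: L2Z. Qed.

Lemma clspan_comb l : clspan (comb l).
Proof.
split; first exact: L2_comb.
move=> eps eps0; exists l; rewrite (_ : (fun x => _) = fun=> 0).
  by rewrite N2_0.
by apply/funext => x; rewrite subrr.
Qed.

Lemma clspan_e i : clspan (e i).
Proof.
rewrite (_ : e i = comb [:: (1, i)]); first exact: clspan_comb.
by apply/funext => x; rewrite /comb big_seq1 mul1r.
Qed.

Lemma clspan_closed_subspace : closed_subspace clspan.
Proof.
split.
- by move=> f [].
- rewrite (_ : (fun=> 0) = comb [::]); first exact: clspan_comb.
  by apply/funext => x; rewrite /comb big_nil.
- move=> f g [f2 fe] [g2 ge]; split; first exact: L2D.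
  move=> eps eps0; have e4 : 0 < eps / 4 by rewrite divr_gt0.
  have [l1 h1] := fe _ e4; have [l2 h2] := ge _ e4.
  exists (l1 ++ l2).
  rewrite (_ : (fun x => _) = fun x => (f x - comb l1 x) + (g x - comb l2 x)).
    apply: le_lt_trans (N2D_le _ _) _; [exact/L2B/L2_comb|exact/L2B/L2_comb|lra].
  by apply/funext => x; rewrite /comb big_cat /=; ring.
- move=> c f [f2 fe]; split; first exact: L2Z.
  move=> eps eps0; have c1 : 0 < sqn c + 1 by rewrite ltr_wpDl// sqn_ge0.
  have [l h] := fe _ (divr_gt0 eps0 c1); exists [seq (c * p.1, p.2) | p <- l].
  rewrite (_ : (fun x => _) = fun x => c * (f x - comb l x)).
    rewrite N2Z; last exact/L2B/L2_comb.
    move: h; rewrite ltr_pdivlMr// mulrDr mulr1 mulrC; apply: le_lt_trans.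
    by rewrite lerDl N2_ge0.
  apply/funext => x; rewrite /comb big_map mulrBr mulr_sumr.
  by congr (_ - _); apply: eq_bigr => p _; rewrite mulrA.
- move=> u f us f2 /cvg_dist0 H; split => // eps eps0.
  have e4 : 0 < eps / 4 by rewrite divr_gt0.
  have [N /(_ N (leqnn N))] := H _ e4; rewrite ger0_norm ?N2_ge0// => h1.
  have [u2 /(_ _ e4)[l h2]] := us N; exists l.
  rewrite (_ : (fun x => _) = fun x => - (u N x - f x) + (u N x - comb l x)).
    apply: le_lt_trans (N2D_le _ _) _.
    - exact/L2N/L2B.
    - exact/L2B/L2_comb.
    - by rewrite N2N; [lra | exact: L2B].
  by apply/funext => x; ring.
Qed.

End Span.

(** Half-open intervals ]c, d] are used throughout because they split without
    overlap and generate the measurable sets. *)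
Definition cind (A : set R) (x : R) : R[i] := (\1_A x : R)%:C.

Lemma cindE (A : set R) x : cind A x = if x \in A then 1 else 0.
Proof. by rewrite /cind indicE; case: ifP. Qed.

Lemma cmeas_cind (A : set R) : measurable A -> cmeas (cind A).
Proof. by move=> mA; apply: cmeas_real; exact: measurable_indic. Qed.

Lemma sqn_cind (A : set R) x : sqn (cind A x) = \1_A x.
Proof. by rewrite sqn_real indicE; case: (x \in A); rewrite ?expr1n ?expr0n. Qed.

Lemma L2_cind (A : set R) : measurable A -> (mu A < +oo)%E -> L2 (cind A).
Proof.
move=> mA fA; apply/L2P; split; first exact: cmeas_cind.
under eq_fun do rewrite sqn_cind.
apply/integrableP; split; first exact/measurable_EFinP/measurable_indic.
under eq_integral do rewrite gee0_abs ?lee_fin//.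
by rewrite integral_indic// setIT.
Qed.

Lemma itv_fin (c d : R) : (mu `]c, d]%classic < +oo)%E.
Proof. by rewrite lebesgue_measure_itv /=; case: ifP => _; rewrite ?ltry// -EFinB ltry. Qed.

Lemma L2_itv (c d : R) : L2 (cind `]c, d]).
Proof. by apply: L2_cind; [exact: measurable_itv|exact: itv_fin]. Qed.

Lemma cind_itv (c d x : R) : cind `]c, d] x = if c < x <= d then 1 else 0.
Proof. by rewrite cindE mem_setE in_itv. Qed.

Lemma indic_itv (c d x : R) : \1_(`]c, d]%classic) x = if c < x <= d then 1 else 0 :> R.
Proof. by rewrite indicE mem_setE in_itv /=; case: ifP. Qed.

Section Theory.
Variable (M : (R -> R[i]) -> Prop).
Hypothesis clM : closed_subspace M.

Lemma cs_L2 f : M f -> L2 f. Proof. by case: clM => + _ _ _ _; exact. Qed.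
Lemma cs0 : M (fun=> 0). Proof. by case: clM. Qed.
Lemma csD f g : M f -> M g -> M (fun x => f x + g x).
Proof. by case: clM => _ _ + _ _; exact. Qed.
Lemma csZ c f : M f -> M (fun x => c * f x).
Proof. by case: clM => _ _ _ + _; exact. Qed.
Lemma cs_lim (u : nat -> R -> R[i]) f : (forall n, M (u n)) -> L2 f ->
  N2 (fun x => u n x - f x) @[n --> \oo] --> (0 : R) -> M f.
Proof. by case: clM => _ _ _ _; exact. Qed.

Lemma csB f g : M f -> M g -> M (fun x => f x - g x).
Proof.
move=> Mf Mg; rewrite (_ : (fun x => _) = fun x => f x + (-1) * g x).
  by apply: csD => //; exact: csZ.
by apply/funext => x; rewrite mulN1r.
Qed.

Lemma cs_sum (I : Type) (s : seq I) (F : I -> R -> R[i]) :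
  (forall i, M (F i)) -> M (fun x => \sum_(i <- s) F i x).
Proof.
move=> mF; elim: s => [|i s IH].
  by under eq_fun do rewrite big_nil; exact: cs0.
by under eq_fun do rewrite big_cons; exact: csD.
Qed.

Lemma cs_ae f g : M f -> cmeas g -> {ae mu, forall x, f x = g x} -> M g.
Proof.
move=> Mf mg fg; have [g2 N0] := ae_eq_N2 (cs_L2 Mf) mg fg.
apply: (cs_lim (u := fun=> f)) => //.
by rewrite N0; exact: cvg_cst.
Qed.

Lemma cs_dom (u : nat -> R -> R[i]) f g : (forall n, M (u n)) ->
  cmeas f -> L2 g ->
  (forall n x, sqn (u n x) <= sqn (g x)) -> (forall x, sqn (f x) <= sqn (g x)) ->
  {ae mu, forall x, sqn (u n x - f x) @[n --> \oo] --> (0 : R)} -> M f.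
Proof.
move=> Mu mf g2 ug fg uf; apply: (cs_lim Mu).
  by apply: (L2_dom (K := 1) mf g2) => x; rewrite mul1r.
by apply: (N2_dominated g2) => // n; exact/L2_meas/cs_L2.
Qed.

Variables (a b : R).
Hypothesis ab : a <= b.
Hypothesis Mitv : forall c d, a <= c -> c <= d -> d <= b -> M (cind `]c, d]).
Let J : set R := `]a, b].

(** The sets B for which the indicator of B `&` J belongs to M form a Dynkin
    system, which contains the intersection-stable class of half-open intervals. *)
Lemma cs_measurable (B : set R) : measurable B -> M (cind (B `&` J)).
Proof.
apply: (@dynkin_induction _ (measurableTypeR R) (@ocitv R) (fun B => M (cind (B `&` J)))) => //.
- exact: ocitvI.
- by rewrite setTI; exact: Mitv.
- move=> _ [[c d] _ <-] /=.
  rewrite (_ : _ `&` _ = `]Num.max a c, Num.min b d]%classic); last first.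
    apply/seteqP; split=> x; rewrite /J /= !in_itv /= gt_max le_min.
      by move=> [/andP[-> ->] /andP[-> ->]].
    by move=> /andP[/andP[-> ->] /andP[-> ->]].
  have [h|h] := leP (Num.max a c) (Num.min b d).
    by apply: Mitv => //; rewrite ?le_max ?ge_min lexx.
  rewrite (_ : cind _ = fun=> 0); first exact: cs0.
  by apply/funext => x; rewrite set_itv_ge ?bnd_simp -?leNgt ?ltW// cindE in_set0.
- move=> S mS MS.
  rewrite (_ : cind _ = fun x => cind J x - cind (S `&` J) x).
    by apply: csB => //; exact: Mitv.
  apply/funext => x; rewrite !cindE !in_setI in_setC.
  by case: (x \in S); case: (x \in J) => /=; rewrite ?subrr ?subr0.
- move=> F mF tF MF.
  have mU n : measurable (\big[setU/set0]_(k < n) F k).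
    exact: bigsetU_measurable.
  apply: (cs_dom (u := fun n => cind (\big[setU/set0]_(k < n) F k `&` J)) (g := cind J)).
  + elim=> [|n IH].
      rewrite big_ord0 set0I (_ : cind _ = fun=> 0); first exact: cs0.
      by apply/funext => x; rewrite cindE in_set0.
    rewrite big_ord_recr /=.
    rewrite (_ : cind _ = fun x => cind (\big[setU/set0]_(k < n) F k `&` J) x + cind (F n `&` J) x).
      exact: csD.
    apply/funext => x; rewrite !cindE !in_setI in_setU.
    case: (x \in J); rewrite ?andbF ?addr0// !andbT.
    case: (boolP (x \in F n)) => Fn; last by rewrite orbF addr0.
    rewrite orbT; case: ifPn; rewrite ?add0r//.
    rewrite inE -bigcup_mkord => -[k /= kn Fk].
    have : k = n by apply: tF => //; exists x; split => //; rewrite -inE.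
    by move=> kE; rewrite kE ltnn in kn.
  + apply: cmeas_cind; apply: measurableI; first exact: bigcupT_measurable.
    exact: measurable_itv.
  + exact: L2_itv.
  + move=> n x; rewrite !sqn_cind !indicE in_setI ler_nat.
    by case: (x \in J); rewrite ?andbF ?leq_b1.
  + move=> x; rewrite !sqn_cind !indicE in_setI ler_nat.
    by case: (x \in J); rewrite ?andbF ?leq_b1.
  + apply: aeW => x; apply/cvg_dist0 => e e0.
    have [[k _ Fk]|nF] := pselect ((\bigcup_k F k) x).
      exists k.+1 => n kn; rewrite !cindE !in_setI.
      have -> : x \in \bigcup_k F k by rewrite inE; exists k.
      have -> : x \in \big[setU/set0]_(k < n) F k.
        by rewrite inE -bigcup_mkord; exists k.
      by rewrite subrr sqn0 normr0.
    exists 0%N => n _; rewrite !cindE !in_setI.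
    have -> : (x \in \bigcup_k F k) = false by apply/negbTE; rewrite notin_setE.
    have -> : (x \in \big[setU/set0]_(k < n) F k) = false.
      apply/negbTE; rewrite notin_setE -bigcup_mkord => -[k _ Fk].
      by apply: nF; exists k.
    by rewrite subrr sqn0 normr0.
Qed.

Import HBNNSimple.

(** Simple functions increase to h. *)
Lemma cs_nonneg (h : R -> R) : measurable_fun [set: R] h -> (forall x, 0 <= h x) ->
  (forall x, ~ J x -> h x = 0) -> L2 (fun x => (h x)%:C) ->
  M (fun x => (h x)%:C).
Proof.
move=> mh h0 hJ h2.
have mEh : measurable_fun [set: R] (EFin \o h) by exact/measurable_EFinP.
have h0E x : [set: R] x -> (0%:E <= (EFin \o h) x)%E by rewrite /= lee_fin.
pose u n := nnsfun_approx measurableT mEh n.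
have ucv x : u n x @[n --> \oo] --> h x.
  have := @cvg_nnsfun_approx _ _ _ _ measurableT _ mEh h0E x I.
  by move/fine_cvg; apply.
have ule n x : u n x <= h x.
  have <- : limn (fun n => u n x) = h x by apply/cvg_lim => //; exact: ucv.
  apply: (@nondecreasing_cvgn_le _ (fun n => u n x)) => //; last first.
    by apply/cvg_ex; exists (h x); exact: ucv.
  by move=> m k mk; exact/lefP/nd_nnsfun_approx.
apply: (cs_dom (u := fun n x => (u n x)%:C * cind J x) (g := fun x => (h x)%:C)).
- move=> n.
  have -> : (fun x => (u n x)%:C * cind J x) =
     fun x => \sum_(y <- finmap.enum_fset (fset_set (range (u n))))
        y%:C * cind (u n @^-1` [set y] `&` J) x.
    apply/funext => x; rewrite fimfunE (fsbig_finite _ _ (fimfunP (u n))) /=.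
    rewrite rmorph_sum mulr_suml; apply: eq_bigr => y _ /=.
    by rewrite /cind indicI rmorphM /= rmorphM /= mulrA.
  apply: cs_sum => y; apply: csZ; apply: cs_measurable.
  exact: measurable_sfunP.
- exact: cmeas_real.
- exact: h2.
- move=> n x; rewrite sqnM sqn_cind !sqn_real.
  rewrite (@le_trans _ _ (u n x ^+ 2))//.
    by rewrite ler_piMr ?sqr_ge0// indicE lern1 leq_b1.
  by rewrite ler_sqr ?nnegrE.
- by [].
- apply: aeW => x; have [Jx|/hJ h0x] := pselect (J x).
    rewrite cindE mem_set//; under eq_fun do rewrite mulr1 -rmorphB /= sqn_real.
    have d0 : u n x - h x @[n --> \oo] --> (0 : R).
      by rewrite -(subrr (h x)); apply: cvgB => //; exact: cvg_cst.
    under eq_fun do rewrite expr2.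
    by have H := cvgM d0 d0; rewrite mulr0 in H; exact: H.
  have u0 n : u n x = 0 by apply/eqP; rewrite eq_le -{1}h0x ule/=.
  by under eq_fun do rewrite u0 h0x mul0r subr0 sqn0; exact: cvg_cst.
Qed.

(** This reduces the completeness of a family on an interval to the indicators of
    its subintervals. *)
Theorem cs_full f : L2 f -> (forall x, ~ J x -> f x = 0) -> M f.
Proof.
move=> f2 fJ; have [m1 m2] := L2_meas f2.
have pos (k : R -> R) : measurable_fun [set: R] k ->
    (forall x, ~ J x -> k x = 0) -> (forall x, k x ^+ 2 <= sqn (f x)) ->
    M (fun x => (k x)%:C).
  move=> mk k0 kf.
  have key (h : R -> R) : measurable_fun [set: R] h -> (forall x, 0 <= h x) ->
      (forall x, h x <= `|k x|) -> M (fun x => (h x)%:C).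
    move=> mh h0 hk; apply: cs_nonneg => //.
      move=> x /k0 kx; apply/eqP; rewrite eq_le h0 andbT.
      by have := hk x; rewrite kx normr0.
    apply: (L2_dom (K := 1) _ f2); first exact: cmeas_real.
    move=> x; rewrite mul1r sqn_real (le_trans _ (kf x))// -(real_normK (num_real (k x))).
    by rewrite ler_sqr ?nnegrE.
  rewrite (_ : (fun x => _) = fun x => (Num.max (k x) 0)%:C - (Num.max (- k x) 0)%:C).
    apply: csB; apply: key.
    - by apply: measurable_maxr.
    - by move=> x; rewrite le_max lexx orbT.
    - by move=> x; rewrite ge_max ler_norm normr_ge0.
    - by apply: measurable_maxr => //; exact: measurable_funN.
    - by move=> x; rewrite le_max lexx orbT.
    - by move=> x; rewrite ge_max -normrN ler_norm normr_ge0.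
  apply/funext => x; rewrite -rmorphB; congr (_%:C).
  by case: (leP (k x) 0); case: (leP (- k x) 0); lra.
rewrite (_ : f = fun x => (complex.Re (f x))%:C + 'i%C * (complex.Im (f x))%:C); last first.
  by apply/funext => x; rewrite [LHS]complexE.
apply: csD; last apply: csZ; apply: pos => //.
- by move=> x /fJ ->.
- by move=> x; rewrite /sqn lerDl sqr_ge0.
- by move=> x /fJ ->.
- by move=> x; rewrite /sqn lerDr sqr_ge0.
Qed.

End Theory.
End ClosedSubspaces.

(** * Arcs of the circle as limits of trigonometric polynomials *)

Section Trig.
Context {R : realType}.
Implicit Types (f g h : R -> R[i]) (z w : R[i]).
Local Notation mu := (@lebesgue_measure R).

Lemma cisD (s t : R) : cis (s + t) = cis s * cis t.
Proof. by apply: complex_ext; rewrite !ReImE /= ?cosD ?sinD; ring. Qed.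
Lemma cis0 : cis (0 : R) = 1.
Proof. by rewrite /cis cos0 sin0. Qed.
Lemma cisN (t : R) : cis (- t) = conjc (cis t).
Proof. by rewrite /cis cosN sinN. Qed.
Lemma cis_nat (n : nat) : cis (2 * pi * n%:R : R) = 1.
Proof.
elim: n => [|n IH]; first by rewrite mulr0 cis0.
rewrite -[n.+1%:R]natr1 mulrDr mulr1 cisD IH mul1r mulr_natl.
by rewrite /cis cos2pi sin2pi.
Qed.
Lemma cis_int (m : int) : cis (2 * pi * m%:~R : R) = 1.
Proof.
case: m => n; first exact: cis_nat.
by rewrite NegzE mulrNz mulrN cisN cis_nat conjc1.
Qed.
Lemma cos_int (x : R) (m : int) : cos (x + 2 * pi * m%:~R) = cos x.
Proof.
have : cis (x + 2 * pi * m%:~R) = cis x by rewrite cisD cis_int mulr1.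
by move=> /(congr1 (@complex.Re R)).
Qed.

Definition expk (k : int) (x : R) : R[i] := cis (k%:~R * x).
Lemma cmeas_expk k : cmeas (expk k).
Proof.
apply: (cmeas_comp (a := fun x => k%:~R * x)); last exact: cmeas_cis.
exact: mulrl_measurable.
Qed.
Lemma expkD k l x : expk (k + l) x = expk k x * expk l x.
Proof. by rewrite /expk intrD mulrDl cisD. Qed.

Definition trigpoly f := exists l, f = comb expk l.

Lemma trigpoly_k k : trigpoly (expk k).
Proof.
by exists [:: (1, k)]; apply/funext => x; rewrite /comb big_seq1 mul1r.
Qed.
Lemma trigpolyD f g : trigpoly f -> trigpoly g -> trigpoly (fun x => f x + g x).
Proof.
move=> [l ->] [l' ->]; exists (l ++ l'); apply/funext => x.
by rewrite /comb big_cat.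
Qed.
Lemma trigpolyM f g : trigpoly f -> trigpoly g -> trigpoly (fun x => f x * g x).
Proof.
move=> [l ->] [l' ->].
exists [seq (p.1 * q.1, (p.2 + q.2)%R) | p <- l, q <- l']; apply/funext => x.
rewrite /comb big_allpairs_dep /= mulr_suml; apply: eq_bigr => p _.
rewrite mulr_sumr; apply: eq_bigr => q _.
by rewrite expkD /=; ring.
Qed.
Lemma trigpolyC c : trigpoly (fun=> c).
Proof.
exists [:: (c, 0)]; apply/funext => x.
by rewrite /comb big_seq1 /expk /= mul0r cis0 mulr1.
Qed.
Lemma trigpolyX f n : trigpoly f -> trigpoly (fun x => f x ^+ n).
Proof.
move=> tf; elim: n => [|n IH].
  by under eq_fun do rewrite expr0; exact: trigpolyC.
by under eq_fun do rewrite exprS; exact: trigpolyM.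
Qed.
Lemma trigpoly_cos c : trigpoly (fun x => (cos (x - c))%:C).
Proof.
rewrite (_ : (fun x => _) = fun x => (2^-1)%:C * (cis (- c) * expk 1 x + cis c * expk (-1) x)).
  apply: trigpolyM; first exact: trigpolyC.
  by apply: trigpolyD; (apply: trigpolyM; [exact: trigpolyC|exact: trigpoly_k]).
apply/funext => x; rewrite /expk mul1r mulN1r -!cisD.
rewrite (addrC _ x) (_ : c - x = - (x - c)); last by ring.
rewrite cisN.
by apply: complex_ext; rewrite !ReImE /=; field.
Qed.

Lemma bernoulli_ge (t : R) n : -1 <= t -> 1 + n%:R * t <= (1 + t) ^+ n.
Proof.
move=> t1; elim: n => [|n IH]; first by rewrite mul0r addr0 expr0.
rewrite exprS -natr1; have t0 : 0 <= 1 + t by lra.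
apply: (le_trans _ (ler_wpM2l t0 IH)).
have : 0 <= n%:R * t ^+ 2 by rewrite mulr_ge0 ?sqr_ge0.
lra.
Qed.

(** The polynomials of the Brosowski-Deutsch proof of the Stone-Weierstrass theorem:
    on [0, 1] they take values in [0, 1], and they tend to 1 left of 1/2 and to 0
    right of 1/2. *)
Definition stone n (q : R) : R := (1 - q ^+ n) ^+ (2 ^ n).

Lemma stone_01 n q : 0 <= q <= 1 -> 0 <= stone n q <= 1.
Proof.
move=> /andP[q0 q1]; have := exprn_ge0 n q0; have := exprn_ile1 n q0 q1.
by move=> h1 h0; rewrite exprn_ge0 ?exprn_ile1//; lra.
Qed.

Lemma stone_cvg1 q : 0 <= q < 2^-1 -> stone n q @[n --> \oo] --> (1 : R).
Proof.
move=> /andP[q0 q2].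
have z : 1 - (2 * q) ^+ n @[n --> \oo] --> (1 - 0 : R).
  apply: cvgB; first exact: cvg_cst.
  by apply: cvg_expr; rewrite ger0_norm; lra.
rewrite subr0 in z; apply: (squeeze_cvgr _ z (cvg_cst (1 : R))).
apply: nearW => n; have /andP[_ ->] : 0 <= stone n q <= 1 by apply: stone_01; lra.
rewrite andbT /stone.
have := @bernoulli_ge (- q ^+ n) (2 ^ n); rewrite natrX exprMn mulrN.
apply; rewrite lerN2 exprn_ile1//; lra.
Qed.

Lemma stone_cvg0 q : 2^-1 < q <= 1 -> stone n q @[n --> \oo] --> (0 : R).
Proof.
move=> /andP[q2 q1]; have q0 : 0 < q by lra.
have z : (2 * q)^-1 ^+ n @[n --> \oo] --> (0 : R).
  apply: cvg_expr; rewrite ger0_norm ?invr_ge0 ?invf_lt1//; lra.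
apply: (squeeze_cvgr _ (cvg_cst (0 : R)) z).
apply: nearW => n; have /andP[-> _] : 0 <= stone n q <= 1 by apply: stone_01; lra.
rewrite /= /stone exprVn; set t := q ^+ n.
have t1 : t <= 1 by rewrite exprn_ile1 // ltW.
have t0 : 0 < t by rewrite exprn_gt0.
have m0 : 0 < (2 * q) ^+ n by rewrite exprn_gt0//; lra.
rewrite -[leRHS]mul1r ler_pdivlMr//.
(* Bernoulli bounds the reciprocal: (2 q)^n <= (1 + t)^(2^n), and (1 - t) (1 + t) <= 1 *)
apply: (@le_trans _ _ ((1 - t) ^+ (2 ^ n) * (1 + t) ^+ (2 ^ n))).
  apply: ler_wpM2l; first by rewrite exprn_ge0//; lra.
  have := @bernoulli_ge t (2 ^ n); rewrite natrX -exprMn => h.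
  by apply: (le_trans _ (h _)); lra.
rewrite -exprMn exprn_ile1//; nra.
Qed.

(** The cosine of the distance to the midpoint of an arc decides whether a point
    of the circle lies on the arc. *)
Lemma circ_arc (a b y : R) : 0 <= a -> a < b -> b <= 2 * pi -> 0 < y < 2 * pi ->
  let c := (a + b) / 2 in let d := (b - a) / 2 in
  (a < y < b -> cos d < cos (y - c)) /\ (y < a \/ b < y -> cos (y - c) < cos d).
Proof.
move=> a0 ab b2 /andP[y0 y2] c d.
have d0 : 0 <= d by rewrite /d; lra.
have dp : d <= pi by rewrite /d; lra.
have L (s t : R) : 0 <= s -> s < t -> t <= pi -> cos t < cos s.
  by move=> s0 st tp; rewrite ltr_cos ?in_itv /=; lra.
have cosab (s : R) : cos s = cos `|s| by rewrite cos_norm.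
split.
  move=> yab; rewrite (cosab (y - c)); apply: L => //.
  by rewrite ltr_norml /c /d; lra.
have wrap (s : R) : cos s = cos (2 * pi - s).
  by rewrite -cosN -(cos_int _ 1) mulr1; congr cos; lra.
case=> h.
  have [h1|h1] := leP (c - y) pi.
    by rewrite -(cosN (y - c)) opprB; apply: L; rewrite /c /d in h1 *; lra.
  by rewrite -(cosN (y - c)) opprB wrap; apply: L; rewrite /c /d in h1 *; lra.
have [h1|h1] := leP (y - c) pi.
  by apply: L; rewrite /c /d in h1 *; lra.
by rewrite wrap; apply: L; rewrite /c /d in h1 *; lra.
Qed.

(** Bounded pointwise approximation, off the endpoints, of the indicator of an arc:
    [stone] is applied to the trigonometric polynomial q, which has values in
    [0, 1] and is below 1/2 exactly on the arc. *)
Lemma trig_approx (a b : R) : 0 <= a -> a < b -> b <= 2 * pi ->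
  exists P : nat -> R -> R,
    [/\ forall n, trigpoly (fun x => (P n x)%:C),
        forall n x, 0 <= P n x <= 1 &
        forall y (m : int), 0 < y < 2 * pi -> y != a -> y != b ->
          P n (y + 2 * pi * m%:~R) @[n --> \oo] --> (if a < y < b then 1 else 0 : R)].
Proof.
move=> a0 ab b2; pose c := (a + b) / 2; pose d := (b - a) / 2.
pose q x := 2^-1 - (cos (x - c) - cos d) / 4 : R.
have q01 x : 0 <= q x <= 1.
  have := cos_le1 (x - c); have := cos_geN1 (x - c).
  by have := cos_le1 d; have := cos_geN1 d; rewrite /q; lra.
exists (fun n x => stone n (q x)); split.
- move=> n.
  have tq : trigpoly (fun x => (q x)%:C).
    rewrite (_ : (fun x => _) = fun x => (2^-1 + cos d / 4)%:C + (- 4^-1)%:C * (cos (x - c))%:C).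
      by apply: trigpolyD; [exact: trigpolyC|apply: trigpolyM; [exact: trigpolyC|exact: trigpoly_cos]].
    apply/funext => x; rewrite -rmorphM -rmorphD; congr (_%:C); rewrite /q; lra.
  rewrite (_ : (fun x => _) = fun x => (1 + (-1) * (q x)%:C ^+ n) ^+ (2 ^ n)).
    apply: trigpolyX; apply: trigpolyD; first exact: trigpolyC.
    by apply: trigpolyM; [exact: trigpolyC|exact: trigpolyX].
  by apply/funext => x; rewrite /stone rmorphXn rmorphB rmorphXn mulN1r.
- by move=> n x; exact: stone_01.
- move=> y m y02 ya yb.
  have [h1 h2] := circ_arc a0 ab b2 y02; rewrite -/c -/d in h1 h2.
  have -> : q (y + 2 * pi * m%:~R) = q y.
    by rewrite /q -addrA (addrC _ (- c)) addrA cos_int.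
  have := q01 y; case: ifPn => hy qy.
    by apply: stone_cvg1; have := h1 hy; rewrite /q in qy *; lra.
  have hab : y < a \/ b < y.
    by case: (ltgtP y a) hy ya => // ay; [left|case: (ltgtP y b) yb => //; right].
  by apply: stone_cvg0; have := h2 hab; rewrite /q in qy *; lra.
Qed.

Lemma mod2pi (x : R) : exists y (m : int), x = y + 2 * pi * m%:~R /\ 0 <= y < 2 * pi.
Proof.
have p0 : 0 < 2 * pi :> R by rewrite mulr_gt0 ?pi_gt0.
pose m := Num.floor (x / (2 * pi)); exists (x - 2 * pi * m%:~R), m.
split; first by ring.
have := floor_itv (x / (2 * pi)); rewrite -/m intrD.
rewrite ler_pdivlMr// ltr_pdivrMr// mulrDl mul1r.
by move=> /andP[h1 h2]; apply/andP; split; lra.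
Qed.

Definition periodized (s : seq R) : set R :=
  [set x : R | exists y (m : int), y \in s /\ x = y + 2 * pi * m%:~R].

Lemma countable_periodized s : countable (periodized s).
Proof.
rewrite (_ : periodized s =
    \bigcup_(y in [set` s]) [set y + 2 * pi * m%:~R | m in [set: int]]).
  apply: bigcup_countable; first exact/finite_set_countable/finite_seq.
  by move=> y _; apply: (sub_countable (card_image_le _ _)).
apply/seteqP; split => x.
  by move=> [y [m [ys ->]]]; exists y => //; exists m.
by move=> [y ys [m _ <-]]; exists y, m.
Qed.

Lemma ae_notin_countable (N : set R) : countable N -> {ae mu, forall x, ~ N x}.
Proof.
move=> cN; exists N; split.
- exact: countable_measurable.
- exact: countable_lebesgue_measure0.
- by move=> x /= /contrapT.
Qed.

Variable (M : (R -> R[i]) -> Prop).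
Hypothesis clM : closed_subspace M.
Variable (phi : R -> R[i]).
Hypothesis phi2 : L2 phi.
Hypothesis Mphi : forall k, M (fun x => phi x * expk k x).

(** Multiplication by trigonometric polynomials sees only the fibres y + 2 pi Z, so in
    the limit it cuts phi to the fibres above an arc. The fibres of the endpoints
    and of 0, where the circle is cut open, form a null set. *)
Lemma cs_arc (a b : R) g : 0 <= a -> a < b -> b <= 2 * pi -> cmeas g ->
  (forall y (m : int), 0 < y < 2 * pi -> y != a -> y != b ->
     g (y + 2 * pi * m%:~R) = if a < y < b then phi (y + 2 * pi * m%:~R) else 0) ->
  M g.
Proof.
move=> a0 ab b2 mg gE; have [P [tP P01 Pcv]] := trig_approx a0 ab b2.
have cN := countable_periodized [:: 0; a; b].
have exc := ae_notin_countable cN.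
pose G x := ~ periodized [:: 0; a; b] x.
have nG x : G x -> exists y (m : int), [/\ x = y + 2 * pi * m%:~R, 0 < y < 2 * pi, y != a & y != b].
  move=> Gx; have [y [m [xE /andP[y0 y2]]]] := mod2pi x; exists y, m.
  have ny (z : R) : z \in [:: 0; a; b] -> y != z.
    by move=> zs; apply/eqP => yz; apply: Gx; exists z, m; split => //; rewrite -yz.
  split => //; last 2 first.
  - by apply: ny; rewrite !inE eqxx orbT.
  - by apply: ny; rewrite !inE eqxx !orbT.
  by rewrite lt_neqAle y0 y2 !andbT eq_sym; apply: ny; rewrite !inE eqxx.
(* off the fibres of 0, a and b the function g is the limit; it is set to 0 there
   so that the domination by phi holds everywhere *)
pose L x := g x * cind (~` periodized [:: 0; a; b]) x.
have LE x : G x -> L x = g x by move=> Gx; rewrite /L cindE mem_set ?mulr1.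
have L0 x : ~ G x -> L x = 0.
  by move=> Gx; rewrite /L cindE memNset ?mulr0.
have mL : cmeas L.
  apply: cmeasM => //; apply: cmeas_cind; apply: measurableC.
  exact: countable_measurable.
apply: (@cs_ae _ _ clM L _ _ mg); last by apply: aeS exc => x; exact: LE.
apply: (cs_dom clM (u := fun n x => (P n x)%:C * phi x) (g := phi)) => //.
- move=> n; have [l lE] := tP n.
  rewrite (_ : (fun x => _) = fun x => \sum_(p <- l) p.1 * (phi x * expk p.2 x)).
    by apply: (cs_sum clM) => p; apply: (csZ clM); exact: Mphi.
  apply/funext => x; rewrite (congr1 (@^~ x) lE) /comb mulr_suml.
  by apply: eq_bigr => p _; ring.
- move=> n x; rewrite sqnM sqn_real ler_piMl ?sqn_ge0// exprn_ile1//.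
    by have /andP[] := P01 n x.
  by have /andP[] := P01 n x.
- move=> x; have [Gx|/L0->] := pselect (G x); last by rewrite sqn0 sqn_ge0.
  rewrite LE//; have [y [m [-> y2 ya yb]]] := nG x Gx; rewrite gE//.
  by case: ifP => // _; rewrite sqn0 sqn_ge0.
- apply: aeS exc => x Gx; rewrite LE//.
  have [y [m [-> y2 ya yb]]] := nG x Gx; rewrite gE//.
  have := Pcv y m y2 ya yb; set X := y + _ => PX.
  rewrite (_ : (if _ then _ else _) = (if a < y < b then 1 else 0)%:C * phi X); last first.
    by case: ifP; rewrite ?mul1r ?mul0r.
  under eq_fun do rewrite -mulrBl -rmorphB sqnM sqn_real.
  set t : R := if _ then _ else _ in PX *.
  have d0 : P n X - t @[n --> \oo] --> (0 : R).
    by rewrite -(subrr t); apply: cvgB => //; exact: cvg_cst.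
  have H := cvgM (cvgM d0 d0) (cvg_cst (sqn (phi X))); rewrite !mul0r in H.
  by under eq_fun do rewrite expr2; exact: H.
Qed.

End Trig.

(** * Affine changes of variable *)

Section Affine.
Context {R : realType}.
Implicit Types (f g h : R -> R[i]) (z w : R[i]).
Local Notation mu := (@lebesgue_measure R).

Section ChangeOfVariables.
Variables (a b : R).
Hypothesis a0 : 0 < a.

Let phi (x : measurableTypeR R) : measurableTypeR R := a * x - b.

Let mphi : measurable_fun [set: R] phi.
Proof. by apply: measurable_funB => //; exact: mulrl_measurable. Qed.

Let a00 : 0 <= a. Proof. exact: ltW. Qed.

Lemma affine_pushforward (A : set R) : measurable A ->
  mu A = pushforward (mscale (NngNum a00) mu) phi A.
Proof.
move=> mA; apply: lebesgue_measure_unique => //= _ [[c d]] _ <-.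
rewrite /mscale /pushforward /=.
have -> : phi @^-1` `]c, d] = `](c + b) / a, (d + b) / a]%classic.
  by apply/seteqP; split=> x /=; rewrite !in_itv /= /phi ltr_pdivrMr// ler_pdivlMr// (mulrC x);
    move=> /andP[? ?]; apply/andP; split; lra.
rewrite !lebesgue_measure_itv /= !lte_fin ltr_pM2r ?invr_gt0// ltrD2r.
case: ifP => _; last by rewrite mule0.
rewrite -!EFinB -EFinM; congr (_%:E); field; exact: lt0r_neq0.
Qed.

Lemma ge0_integral_affine (F : R -> \bar R) : measurable_fun [set: R] F ->
  (forall x, 0 <= F x)%E ->
  (\int[mu]_x F x = a%:E * \int[mu]_x F (a * x - b)%R)%E.
Proof.
move=> mF F0.
rewrite (eq_measure_integral (pushforward (mscale (NngNum a00) mu) phi)); last first.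
  by move=> A mA _; exact: affine_pushforward.
rewrite ge0_integral_pushforward// preimage_setT ge0_integral_mscale//.
  by apply: (measurableT_comp mF); exact: mphi.
by move=> x _; exact: F0.
Qed.

Lemma integrable_affine (F : R -> R) : mu.-integrable [set: R] (EFin \o F) ->
  mu.-integrable [set: R] (EFin \o (fun x => F (a * x - b))) /\
  \int[mu]_x F (a * x - b) = a^-1 * \int[mu]_x F x.
Proof.
move=> /[dup] iF /integrableP[mF fF].
have mEF : measurable_fun [set: R] (EFin \o F) by [].
have mFp : measurable_fun [set: R] (EFin \o (fun x => F (a * x - b))).
  by apply: (measurableT_comp mEF); exact: mphi.
have mabs : measurable_fun [set: R] (fun x => `|(F x)%:E|%E).
  exact: (measurableT_comp (@abse_measurable R setT) mEF).
have iFp : mu.-integrable [set: R] (EFin \o (fun x => F (a * x - b))).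
  apply/integrableP; split => //.
  have := ge0_integral_affine mabs; rewrite /= => H.
  rewrite H in fF; last by move=> x; rewrite lee_fin.
  rewrite ltNge leye_eq; apply/negP => /eqP E.
  by move: fF; rewrite /= E gt0_muley ?lte_fin// ltxx.
split => //.
have pos (G : R -> \bar R) : measurable_fun [set: R] G -> (forall x, 0 <= G x)%E ->
    (\int[mu]_x G (a * x - b)%R = a^-1%:E * \int[mu]_x G x)%E.
  move=> mG G0; rewrite (ge0_integral_affine mG G0) muleA -EFinM mulVf ?mul1e//.
  exact: lt0r_neq0.
rewrite /Rintegral.
have -> : (\int[mu]_x (F (a * x - b))%:E = a^-1%:E * \int[mu]_x (F x)%:E)%E.
  rewrite integralE [in RHS]integralE muleBr//; last first.
    by apply: integrable_add_def.
  congr (_ - _)%E.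
    have := pos _ (measurable_funepos mEF) (fun x => funepos_ge0 _ x).
    by move=> <-; apply: eq_integral => x _; rewrite !funeposE.
  have := pos _ (measurable_funeneg mEF) (fun x => funeneg_ge0 _ x).
  by move=> <-; apply: eq_integral => x _; rewrite !funenegE.
by rewrite fineM// integrable_fin_num.
Qed.

Lemma cintegrable_affine f : cintegrable f -> cintegrable (fun x => f (a * x - b)).
Proof.
move=> [f1 f2]; split.
  by have [] := integrable_affine f1.
by have [] := integrable_affine f2.
Qed.

Lemma cintegral_affine f : cintegrable f ->
  cintegral (fun x => f (a * x - b)) = (a^-1)%:C * cintegral f.
Proof.
move=> [f1 f2]; apply: complex_ext; rewrite !ReImE /= mul0r ?subr0 ?addr0.
  by have [_ ->] := integrable_affine f1.
by have [_ ->] := integrable_affine f2.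
Qed.

Definition dil f (x : R) : R[i] := (Num.sqrt a)%:C * f (a * x - b).

Lemma cmeas_dil f : cmeas f -> cmeas (dil f).
Proof.
move=> mf; apply: cmeasM; first exact: cmeas_cst.
by apply: cmeas_comp mf; exact: mphi.
Qed.

Lemma sqn_dil f x : sqn (dil f x) = a * sqn (f (a * x - b)).
Proof. by rewrite sqnM sqn_real sqr_sqrtr. Qed.

Lemma L2_dil f : L2 f -> L2 (dil f).
Proof.
move=> /L2P[mf ig]; apply/L2P; split; first exact: cmeas_dil.
under eq_fun do rewrite sqn_dil; apply: integrableMl.
by have [] := integrable_affine ig.
Qed.

Lemma dot_dil f g : L2 f -> L2 g -> dotL2 (dil f) (dil g) = dotL2 f g.
Proof.
move=> f2 g2; have fg := cintegrable_dot f2 g2.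
rewrite /dotL2 (_ : (fun x => _) =
   fun x => a%:C * (fun y => f y * conjc (g y)) (a * x - b)); last first.
  apply/funext => x; rewrite /dil conjM.
  have -> : a%:C = (Num.sqrt a)%:C * conjc (Num.sqrt a)%:C.
    by rewrite mulcJ sqn_real sqr_sqrtr.
  by ring.
rewrite cintegralZ; last exact: (cintegrable_affine fg).
rewrite (cintegral_affine fg) mulrA -rmorphM mulfV ?rmorph1 ?mul1r//.
exact: lt0r_neq0.
Qed.

Lemma N2_dil f : L2 f -> N2 (dil f) = N2 f.
Proof.
move=> f2; have := dot_dil f2 f2; rewrite !dotE.
by move=> /(congr1 (@complex.Re R)).
Qed.

End ChangeOfVariables.
End Affine.

(** * The Fourier integral *)

Section Fourier.
Context {R : realType}.
Implicit Types (f g h : R -> R[i]) (z w : R[i]).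
Local Notation mu := (@lebesgue_measure R).
Local Notation Re := (@complex.Re R).
Local Notation Im := (@complex.Im R).

Lemma normcE z : Normc.normc z = Num.sqrt (sqn z).
Proof. by case: z. Qed.

Lemma Re_le_normc z : `|Re z| <= Normc.normc z.
Proof. by rewrite normcE -sqrtr_sqr ler_wsqrtr// lerDl sqr_ge0. Qed.

Lemma Im_le_normc z : `|Im z| <= Normc.normc z.
Proof. by rewrite normcE -sqrtr_sqr ler_wsqrtr// lerDr sqr_ge0. Qed.

Lemma normc_le z : Normc.normc z <= `|Re z| + `|Im z|.
Proof.
rewrite normcE -[leRHS]ger0_norm ?addr_ge0// -sqrtr_sqr ler_wsqrtr//.
rewrite /sqn sqrrD !real_normK ?num_real//.
by rewrite lerD2r lerDl mulrn_wge0// mulr_ge0.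
Qed.

Lemma L1_cintegrable f : cLfun 1%:E f -> cintegrable f.
Proof.
move=> [m1 m2]; rewrite /cLnorm Lnorm1 => fin.
have mn : measurable_fun [set: R] (fun x => Normc.normc (f x)).
  under eq_fun do rewrite normcE.
  apply: (measurableT_comp (f := @Num.sqrt R)).
    by apply: continuous_measurable_fun; exact: sqrt_continuous.
  by apply: measurable_sqn; split.
have i : mu.-integrable [set: R] (EFin \o (fun x => Normc.normc (f x))).
  by apply/integrableP; split => //; exact/measurable_EFinP.
apply: (cintegrable_dom _ i); first by split.
  by move=> x; exact: Re_le_normc.
by move=> x; exact: Im_le_normc.
Qed.

Lemma cintegrable_L1 f : cintegrable f -> cLfun 1%:E f.
Proof.
move=> [i1 i2]; have [m1 m2] := cintegrable_meas (conj i1 i2); split => //.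
rewrite /cLnorm Lnorm1.
have i := integrableDr (integrable_norm i1) (integrable_norm i2).
apply: (@le_lt_trans _ _ (\int[mu]_x (`|Re (f x)| + `|Im (f x)|)%:E)%E).
  apply: ge0_le_integral => //.
  - apply/measurable_EFinP; apply: measurableT_comp => //.
    apply/measurable_EFinP.
    under eq_fun do rewrite normcE.
    apply/measurable_EFinP; apply: (measurableT_comp (f := @Num.sqrt R)).
      by apply: continuous_measurable_fun; exact: sqrt_continuous.
    by apply: measurable_sqn; split.
  - by case/integrableP : i.
  - move=> x _; rewrite lee_fin ger0_norm ?normc_le// normcE sqrtr_ge0//.
have /integrableP[_] := i; apply: le_lt_trans.
rewrite le_eqVlt; apply/orP; left; apply/eqP; apply: eq_integral => x _.
by rewrite gee0_abs // lee_fin; exact: addr_ge0 (normr_ge0 _) (normr_ge0 _).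
Qed.

Lemma Re_unit_le z w : sqn w = 1 -> `|Re (z * w)| <= `|Re z| + `|Im z|.
Proof.
move=> w1; apply: (le_trans (Re_le_normc _)); rewrite normcE sqnM w1 mulr1 -normcE.
exact: normc_le.
Qed.
Lemma Im_unit_le z w : sqn w = 1 -> `|Im (z * w)| <= `|Re z| + `|Im z|.
Proof.
move=> w1; apply: (le_trans (Im_le_normc _)); rewrite normcE sqnM w1 mulr1 -normcE.
exact: normc_le.
Qed.

Lemma cintegrable_abs f : cintegrable f ->
  mu.-integrable [set: R] (EFin \o (fun x => `|Re (f x)| + `|Im (f x)|)).
Proof.
by move=> [i1 i2]; exact: (integrableDr (integrable_norm i1) (integrable_norm i2)).
Qed.

Lemma cmeas_cisl (t : R) : cmeas (fun x => cis (t * x)).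
Proof.
apply: (cmeas_comp (a := fun x => t * x)); last exact: cmeas_cis.
exact: mulrl_measurable.
Qed.

Lemma cintegrable_unit f h : cintegrable f -> cmeas h -> (forall x, sqn (h x) = 1) ->
  cintegrable (fun x => f x * h x).
Proof.
move=> i mh h1; apply: (cintegrable_dom _ (cintegrable_abs i)).
- by apply: cmeasM => //; exact: cintegrable_meas.
- by move=> x; exact: Re_unit_le.
- by move=> x; exact: Im_unit_le.
Qed.

Lemma cintegrable_cis f xi : cintegrable f ->
  cintegrable (fun x => f x * cis (- (xi * x))).
Proof.
move=> i; apply: cintegrable_unit => //; last by move=> x; exact: sqn_cis.
by under eq_fun do rewrite -mulNr; exact: cmeas_cisl.
Qed.

Lemma fourier1D f g xi : cintegrable f -> cintegrable g ->
  fourier1 (fun x => f x + g x) xi = fourier1 f xi + fourier1 g xi.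
Proof.
move=> fi gi; rewrite /fourier1 -cintegralD; try exact: cintegrable_cis.
by congr cintegral; apply/funext => x; rewrite mulrDl.
Qed.

Lemma fourier1Z c f xi : cintegrable f ->
  fourier1 (fun x => c * f x) xi = c * fourier1 f xi.
Proof.
move=> fi; rewrite /fourier1 -cintegralZ; try exact: cintegrable_cis.
by congr cintegral; apply/funext => x; rewrite mulrA.
Qed.

Lemma cmeas_fourier1 f : cintegrable f -> cmeas (fourier1 f).
Proof.
move=> i.
have cont (F : R -> R -> R) : (forall l, mu.-integrable [set: R] (EFin \o F l)) ->
    (forall y, continuous (F ^~ y)) ->
    (forall l y, `|F l y| <= `|Re (f y)| + `|Im (f y)|) ->
    measurable_fun [set: R] (fun l => \int[mu]_y F l y).
  move=> iF cF dF; apply: continuous_measurable_fun => l.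
  have := @continuity_under_integral R _ _ mu F [set: R] measurableT (l - 1) (l + 1).
  move=> H; apply: (H _ _ (fun y => `|Re (f y)| + `|Im (f y)|)) => //.
  - by apply: aeW => y _ x _; exact: cF.
  - exact: cintegrable_abs.
  - by move=> x _; apply: aeW => y _; exact: dF.
  - by rewrite inE /= in_itv /=; apply/andP; split; lra.
have cc (y : R) : continuous (fun l : R => cos (- (l * y))).
  by move=> l; apply: continuous_comp; [apply: cvgN; apply: cvgM; [exact: cvg_id|exact: cvg_cst]|exact: continuous_cos].
have cs (y : R) : continuous (fun l : R => sin (- (l * y))).
  by move=> l; apply: continuous_comp; [apply: cvgN; apply: cvgM; [exact: cvg_id|exact: cvg_cst]|exact: continuous_sin].
split; rewrite /fourier1 /cintegral /=; apply: cont.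
- by move=> l; have [] := cintegrable_cis l i.
- move=> y l; rewrite (_ : (fun l => _) = fun l : R => Re (f y) * cos (- (l * y)) - Im (f y) * sin (- (l * y))).
    by apply: cvgB; (apply: cvgM; [exact: cvg_cst|]); [exact: cc|exact: cs].
  by apply/funext => k; rewrite ReM.
- by move=> l y; apply: Re_unit_le; exact: sqn_cis.
- by move=> l; have [] := cintegrable_cis l i.
- move=> y l; rewrite (_ : (fun l => _) = fun l : R => Re (f y) * sin (- (l * y)) + Im (f y) * cos (- (l * y))).
    by apply: cvgD; (apply: cvgM; [exact: cvg_cst|]); [exact: cs|exact: cc].
  by apply/funext => k; rewrite ImM.
- by move=> l y; apply: Im_unit_le; exact: sqn_cis.
Qed.

Lemma L2_unit h f : cmeas h -> (forall x, sqn (h x) = 1) -> L2 f ->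
  L2 (fun x => h x * f x).
Proof. by move=> mh h1; apply: (L2Mb (K := 1)) => // x; rewrite h1. Qed.

Lemma N2_unit h f : (forall x, sqn (h x) = 1) -> N2 (fun x => h x * f x) = N2 f.
Proof.
by move=> h1; rewrite /N2; apply: eq_Rintegral => x _; rewrite sqnM h1 mul1r.
Qed.

Section Dilation.
Variables (a b : R).
Hypothesis a0 : 0 < a.

(** The operator on the Fourier side that corresponds to [dil a b]. *)
Definition fdil g (xi : R) : R[i] := cis (- (b / a) * xi) * dil a^-1 0 g xi.

Let iva0 : 0 < a^-1. Proof. by rewrite invr_gt0. Qed.

Lemma cintegrable_dil f : cintegrable f -> cintegrable (dil a b f).
Proof. by move=> i; apply: cintegrableZ; exact: cintegrable_affine. Qed.

Lemma fourier1_dil f xi : cintegrable f -> fourier1 (dil a b f) xi = fdil (fourier1 f) xi.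
Proof.
move=> i; have an0 : a != 0 by exact: lt0r_neq0.
rewrite /fourier1 /fdil /dil subr0.
have -> : (fun x => (Num.sqrt a)%:C * f (a * x - b) * cis (- (xi * x))) =
   fun x => ((Num.sqrt a)%:C * cis (- (b / a) * xi)) *
      (fun y => f y * cis (- (a^-1 * xi * y))) (a * x - b).
  apply/funext => x /=.
  rewrite (_ : - (xi * x) = - (b / a) * xi + - (a^-1 * xi * (a * x - b))).
    by rewrite cisD; ring.
  by field.
rewrite cintegralZ; last first.
  by apply: (cintegrable_affine b a0 (f := fun y => f y * cis (- (a^-1 * xi * y)))); exact: cintegrable_cis.
rewrite (cintegral_affine b a0 (f := fun y => f y * cis (- (a^-1 * xi * y)))); last exact: cintegrable_cis.
rewrite mulrA (mulrC _%:C (cis _)) -!mulrA; congr (_ * _).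
rewrite mulrA -rmorphM; congr (_%:C * _).
rewrite sqrtrV; last exact: ltW.
rewrite -[X in _ * X^-1](sqr_sqrtr (ltW a0)) expr2 invfM mulrA divff ?mul1r//.
by rewrite sqrtr_eq0 -ltNge.
Qed.

Lemma L2_fdil g : L2 g -> L2 (fdil g).
Proof.
move=> g2; apply: L2_unit; [exact: cmeas_cisl|by move=> x; exact: sqn_cis|].
exact: L2_dil.
Qed.

Lemma N2_fdil g : L2 g -> N2 (fdil g) = N2 g.
Proof. by move=> g2; rewrite N2_unit ?N2_dil// => x; exact: sqn_cis. Qed.

End Dilation.
End Fourier.

(** * Fourier series on an interval of length 2 pi *)

Section FourierSeries.
Context {R : realType}.
Implicit Types (f g h u v : R -> R[i]) (z w : R[i]).
Local Notation mu := (@lebesgue_measure R).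
Local Notation Re := (@complex.Re R).
Local Notation Im := (@complex.Im R).

(** Orthogonality computes distances for distinct indices only, whereas the lists of
    [comb] may repeat them. *)
Lemma comb_uniq (I : eqType) (e : I -> R -> R[i]) (l : seq (R[i] * I)) (s : seq I) :
  uniq s -> (forall p, p \in l -> p.2 \in s) ->
  comb e l = fun x => \sum_(i <- s) (\sum_(p <- l | p.2 == i) p.1) * e i x.
Proof.
move=> us ls; apply/funext => x; rewrite /comb.
under [RHS]eq_bigr do rewrite mulr_suml.
rewrite (exchange_big_dep predT)//= [LHS]big_seq [RHS]big_seq.
apply: eq_bigr => p pl; rewrite -big_filter.
rewrite (_ : [seq i <- s | p.2 == i] = [:: p.2]) ?big_seq1//.
rewrite -(@eq_filter _ (pred1 p.2)); last by move=> i /=; rewrite eq_sym.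
by rewrite filter_pred1_uniq// ls.
Qed.

Lemma cvg_N2 (u : nat -> R -> R[i]) f : (forall n, L2 (u n)) -> L2 f ->
  N2 (fun x => u n x - f x) @[n --> \oo] --> (0 : R) -> N2 (u n) @[n --> \oo] --> N2 f.
Proof.
move=> u2 f2 H.
have H1 : nrm (fun x => u n x - f x) @[n --> \oo] --> (0 : R).
  rewrite -(@sqrtr0 R); apply: (continuous_cvg _ _ H); exact: sqrt_continuous.
have H2 : nrm (u n) @[n --> \oo] --> nrm f.
  apply/cvgrPdist_le => e e0; move/cvg_dist0 : H1 => /(_ e e0)[N HN].
  exists N => // n /= /HN; rewrite ger0_norm ?nrm_ge0// => h.
  rewrite distrC; apply: (le_trans (nrm_dist (u2 n) f2)); exact: ltW.
have : nrm (u n) * nrm (u n) @[n --> \oo] --> nrm f * nrm f by exact: cvgM.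
rewrite -expr2 nrm_sqr.
by under eq_fun do rewrite -expr2 nrm_sqr.
Qed.

Lemma cvgL2P (u : nat -> R -> R[i]) f : (forall n, L2 (u n)) -> L2 f ->
  cvgL2 u f <-> N2 (fun x => u n x - f x) @[n --> \oo] --> (0 : R).
Proof.
move=> u2 f2; have d2 n : L2 (fun x => u n x - f x) by exact: L2B.
rewrite /cvgL2; under eq_fun do rewrite cLnormE//.
split.
  move=> /fine_cvg H.
  have H1 : nrm (fun x => u n x - f x) @[n --> \oo] --> (0 : R) by exact: H.
  pose t n := nrm (fun x => u n x - f x).
  have : t n * t n @[n --> \oo] --> (0 * 0 : R) by exact: cvgM.
  by rewrite mulr0 /t; under eq_fun do rewrite -expr2 nrm_sqr.
move=> H; apply: cvg_EFin; first exact: nearW.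
rewrite -(@sqrtr0 R); apply: (continuous_cvg _ _ H); exact: sqrt_continuous.
Qed.

Lemma cintegrable_supp u (c d : R) : L2 u -> (forall x, ~ `]c, d]%classic x -> u x = 0) ->
  cintegrable u.
Proof.
move=> u2 u0; have [mu_ iu] := (L2P u).1 u2.
have i1 : mu.-integrable [set: R] (EFin \o (fun x => \1_(`]c, d]%classic) x : R)).
  have /L2P[_] := @L2_itv R c d.
  by under eq_fun do rewrite sqn_cind.
apply: (cintegrable_dom (b := fun x => sqn (u x) + \1_(`]c, d]%classic) x)) => //.
- exact: integrableDr.
- move=> x; have [xJ|xJ] := pselect (`]c, d]%classic x); last first.
    by rewrite u0// normr0 addr_ge0 ?sqn_ge0.
  rewrite indicE mem_set// mulr1n /sqn -(real_normK (num_real (Re (u x)))).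
  have := sqr_ge0 (Im (u x)); have := sqr_ge0 (`|Re (u x)| - 1); rewrite sqrrB1.
  by have := normr_ge0 (Re (u x)); lra.
- move=> x; have [xJ|xJ] := pselect (`]c, d]%classic x); last first.
    by rewrite u0// normr0 addr_ge0 ?sqn_ge0.
  rewrite indicE mem_set// mulr1n /sqn -(real_normK (num_real (Im (u x)))).
  have := sqr_ge0 (Re (u x)); have := sqr_ge0 (`|Im (u x)| - 1); rewrite sqrrB1.
  by have := normr_ge0 (Im (u x)); lra.
Qed.

Definition chint (c d t : R) : R[i] := cintegral (fun x => cind `]c, d] x * cis (t * x)).

Lemma cintegrable_chint (c d t : R) : cintegrable (fun x => cind `]c, d] x * cis (t * x)).
Proof.
apply: (@cintegrable_supp _ c d).
  rewrite (_ : (fun x => _) = fun x => cis (t * x) * cind `]c, d] x).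
    by apply: L2_unit; [exact: cmeas_cisl|by move=> x; exact: sqn_cis|exact: L2_itv].
  by apply/funext => x; rewrite mulrC.
by move=> x xJ; rewrite cindE memNset// mul0r.
Qed.

Lemma chint_split (c e d t : R) : c <= e -> e <= d ->
  chint c d t = chint c e t + chint e d t.
Proof.
move=> ce ed; rewrite /chint -cintegralD; try exact: cintegrable_chint.
congr cintegral; apply/funext => x; rewrite -mulrDl !cind_itv; congr (_ * _).
by case: (ltP c x); case: (leP x d); case: (leP x e) => /= *; rewrite ?addr0 ?add0r//; exfalso; lra.
Qed.

Lemma chint_shift (c d t h : R) : chint (c + h) (d + h) t = cis (t * h) * chint c d t.
Proof.
rewrite /chint -cintegralZ; last exact: cintegrable_chint.
have := @cintegral_affine R 1 h ltr01 (fun x => cis (t * h) * (cind `]c, d] x * cis (t * x))).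
rewrite invr1 mul1r => <-; last by apply: cintegrableZ; exact: cintegrable_chint.
congr cintegral; apply/funext => x; rewrite mul1r !cind_itv ltrBrDr lerBlDr.
by case: ifP; rewrite ?mul0r ?mulr0// !mul1r -cisD -mulrDr (_ : h + (x - h) = x)//; ring.
Qed.

(** A translation by h leaves the integral over a full period unchanged and
    multiplies it by cis (n h); for h = pi / |n| this factor is -1. *)
Lemma chint_circle (n : int) : chint 0 (2 * pi) n%:~R = if n == 0 then (2 * pi)%:C else 0.
Proof.
have p0 := pi_gt0 R.
case: eqVneq => [->|n0].
  rewrite /chint; under eq_fun do rewrite mul0r cis0 mulr1.
  rewrite /cintegral /cind /=; apply: complex_ext => /=.
    transitivity (fine (mu `]0%R, 2 * pi]%classic)).
      by congr fine; rewrite integral_indic ?setIT//; exact: measurable_itv.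
    by rewrite lebesgue_measure_itv /= lte_fin mulr_gt0//= subr0.
  by rewrite Rintegral_cst// mul0r.
have n1 : 1 <= `|n|%:~R :> R by rewrite ler1z -gtz0_ge1 normr_gt0.
pose h : R := pi / `|n|%:~R.
have h0 : 0 < h by rewrite divr_gt0//; lra.
have hp : h <= pi by rewrite ler_pdivrMr; [nra | lra].
have H : chint h (2 * pi + h) n%:~R = - chint 0 (2 * pi) n%:~R.
  rewrite -{1}(add0r h) chint_shift (_ : cis _ = -1) ?mulN1r//.
  have [n_ge0|n_lt0] := leP 0 n.
    rewrite /h ger0_norm// (_ : _ * _ = pi); last by field; rewrite intr_eq0.
    by rewrite /cis cospi sinpi; apply: complex_ext => /=; rewrite ?oppr0.
  rewrite /h ltr0_norm// (_ : _ * _ = - pi).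
    by rewrite /cis cosN sinN cospi sinpi; apply: complex_ext => /=; rewrite ?oppr0.
  by rewrite intrN; field; rewrite intr_eq0.
have : chint h (2 * pi + h) n%:~R = chint 0 (2 * pi) n%:~R.
  rewrite (@chint_split h (2 * pi)); [|lra|lra].
  rewrite -{2}(add0r (2 * pi)) (addrC _ h) chint_shift.
  rewrite (mulrC n%:~R) cis_int mul1r addrC -chint_split//; [exact: ltW|lra].
rewrite H => E; have : chint 0 (2 * pi) n%:~R *+ 2 = 0 by rewrite mulr2n -{1}E addNr.
by move=> /eqP; rewrite mulrn_eq0 /= => /eqP.
Qed.

Definition circ_char (k : int) (x : R) : R[i] := expk k x * cind `]0, 2 * pi] x.

Lemma L2_circ_char k : L2 (circ_char k).
Proof.
by apply: L2_unit; [exact: cmeas_expk|by move=> x; exact: sqn_cis|exact: L2_itv].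
Qed.

Lemma cindM (A : set R) x : cind A x * conjc (cind A x) = cind A x.
Proof. by rewrite mulcJ sqn_cind. Qed.

Lemma dot_circ_char k l :
  dotL2 (circ_char k) (circ_char l) = if k == l then (2 * pi)%:C else 0.
Proof.
rewrite -subr_eq0 -chint_circle /dotL2 /chint; congr cintegral; apply/funext => x.
rewrite /circ_char conjM mulrACA cindM /expk mulrC -cisN -cisD -mulNr -mulrDl.
by rewrite intrB.
Qed.

Lemma N2_circ_char k : N2 (circ_char k) = 2 * pi.
Proof.
by have := dot_circ_char k k; rewrite dotE eqxx => /(congr1 Re).
Qed.

Section Parseval.
Variable v : R -> R[i].
Hypothesis v2 : L2 v.
Let c k := dotL2 v (circ_char k).

Lemma dot_sum_circ (s : seq int) (a : int -> R[i]) l : l \notin s ->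
  dotL2 (fun x => \sum_(k <- s) a k * circ_char k x) (circ_char l) = 0.
Proof.
elim: s => [|k s IH].
  move=> _; rewrite /dotL2 (_ : (fun x => _) = fun=> 0).
    by rewrite /cintegral /= Rintegral_cst// mul0r.
  by apply/funext => x; rewrite big_nil mul0r.
rewrite inE negb_or => /andP[lk ls].
rewrite (_ : (fun x => _) = fun x => a k * circ_char k x + \sum_(j <- s) a j * circ_char j x).
  rewrite dotDl ?dotZl ?IH ?dot_circ_char//; try exact: L2_circ_char.
  - by rewrite eq_sym (negbTE lk) mulr0 addr0.
  - by apply: L2Z; exact: L2_circ_char.
  - by apply: L2_sum => j; apply: L2Z; exact: L2_circ_char.
by apply/funext => x; rewrite big_cons.
Qed.

Lemma N2_sub_circ (s : seq int) (a : int -> R[i]) : uniq s ->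
  N2 (fun x => v x - \sum_(k <- s) a k * circ_char k x) =
  N2 v + \sum_(k <- s) (2 * pi * sqn (a k) - 2 * Re (conjc (a k) * c k)).
Proof.
elim: s => [|k s IH].
  move=> _; rewrite big_nil addr0; congr N2; apply/funext => x.
  by rewrite big_nil subr0.
move=> /= /andP[ks us].
have S2 : L2 (fun x => \sum_(j <- s) a j * circ_char j x).
  by apply: L2_sum => j; apply: L2Z; exact: L2_circ_char.
have k2 : L2 (fun x => - a k * circ_char k x) by apply: L2Z; exact: L2_circ_char.
rewrite (_ : (fun x => _) = fun x =>
  (v x - \sum_(j <- s) a j * circ_char j x) + - a k * circ_char k x); last first.
  by apply/funext => x; rewrite big_cons; ring.
rewrite N2D ?IH ?N2Z//; [|exact: L2_circ_char|exact: L2B].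
rewrite dotZr; [|exact: L2_circ_char|exact: L2B].
rewrite (_ : (fun x => v x - _) = fun x => v x + (-1) * \sum_(j <- s) a j * circ_char j x).
  rewrite dotDl ?dotZl ?dot_sum_circ//; try exact: L2_circ_char; last exact: L2Z.
  rewrite mulr0 addr0 -/(c k) N2_circ_char sqnN big_cons.
  rewrite (_ : conjc (- a k) * c k = - (conjc (a k) * c k)).
    by rewrite ReN; ring.
  by apply: complex_ext; rewrite !ReImE; ring.
by apply/funext => x; rewrite mulN1r.
Qed.

Let p0 : 0 < 2 * pi :> R. Proof. by rewrite mulr_gt0 ?pi_gt0. Qed.

Lemma Bessel (s : seq int) : uniq s -> \sum_(k <- s) sqn (c k) <= 2 * pi * N2 v.
Proof.
move=> us; have := N2_ge0 (fun x => v x - \sum_(k <- s) ((2 * pi)^-1%:C * c k) * circ_char k x).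
rewrite N2_sub_circ// (_ : \sum_(k <- s) _ = - (2 * pi)^-1 * \sum_(k <- s) sqn (c k)).
  by rewrite mulNr subr_ge0 mulrC ler_pdivrMr// mulrC.
rewrite mulr_sumr; apply: eq_bigr => k _.
rewrite sqnM sqn_real; move: (c k) (lt0r_neq0 p0) => z.
by move: (2 * pi) => P Pn0; rewrite /sqn !ReImE /=; field.
Qed.

(** Among all combinations with indices in s, the partial Fourier series is the
    closest to v; the left-hand side is 2 pi times its squared distance. *)
Lemma best_approximation (s : seq int) (l : seq (R[i] * int)) : uniq s ->
  (forall p, p \in l -> p.2 \in s) ->
  2 * pi * N2 v - \sum_(k <- s) sqn (c k) <= 2 * pi * N2 (fun x => v x - comb circ_char l x).
Proof.
move=> us ls; rewrite (comb_uniq circ_char us ls).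
pose a k := \sum_(p <- l | p.2 == k) p.1; rewrite -/(a _).
have -> := N2_sub_circ a us.
rewrite -subr_ge0 (_ : _ - _ = \sum_(k <- s) sqn ((2 * pi)%:C * a k - c k)).
  by apply: sumr_ge0 => k _; exact: sqn_ge0.
transitivity (2 * pi * (\sum_(k <- s) (2 * pi * sqn (a k) - 2 * Re (conjc (a k) * c k))) +
  \sum_(k <- s) sqn (c k)); first by ring.
rewrite mulr_sumr -big_split /=; apply: eq_bigr => k _.
by move: (c k) (a k) => z w; rewrite /sqn !ReImE /=; ring.
Qed.

Definition int_range (n : nat) : seq int := [seq (i%:Z - n%:Z)%R | i <- iota 0 (2 * n)].

Lemma uniq_int_range n : uniq (int_range n).
Proof.
rewrite map_inj_uniq ?iota_uniq// => i j /addIr /eqP.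
by rewrite eqz_nat => /eqP.
Qed.

Lemma mem_int_range n (k : int) : (`|k| < n)%N -> k \in int_range n.
Proof.
move=> kn; apply/mapP; exists (absz (k + n%:Z)); first by rewrite mem_iota; lia.
lia.
Qed.

Hypothesis v_supp : forall x, ~ `]0, 2 * pi]%classic x -> v x = 0.

(** By [cs_full] it suffices to reach the indicators of arcs, which is [cs_arc]
    for phi the indicator of the whole circle. *)
Lemma circ_complete : clspan circ_char v.
Proof.
have clM := clspan_closed_subspace L2_circ_char.
apply: (cs_full clM (ltW p0) _ v2 v_supp) => a b a0 ab b2.
have [->|neq] := eqVneq a b.
  rewrite (_ : cind _ = fun=> 0); first exact: cs0 clM.
  by apply/funext => x; rewrite cind_itv; case: ifP => // ?; exfalso; lra.
have altb : a < b by rewrite lt_neqAle neq.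
apply: (cs_arc clM (L2_itv 0 (2 * pi)) _ a0 altb b2).
- move=> k; rewrite (_ : (fun x => _) = circ_char k); first exact/clspan_e/L2_circ_char.
  by apply/funext => x; rewrite mulrC.
- exact: L2_meas (L2_itv a b).
- move=> y m /andP[y0 y2] ya yb; rewrite !cind_itv.
  have [m0|m0] := eqVneq m 0.
    rewrite m0 mulr0 addr0 y0 (ltW y2) /=.
    by rewrite (le_eqVlt y) (negbTE yb) /=.
  have Hx : ~~ (0 < y + 2 * pi * m%:~R <= 2 * pi).
    have [mp|mn] := ltP 0 m.
      have m1 : 1 <= m%:~R :> R by rewrite ler1z -gtz0_ge1.
      have := ler_wpM2l (ltW p0) m1; lra.
    have m1 : m%:~R <= - 1 :> R by rewrite -(intrN _ 1) ler_int; clear - m0 mn; lia.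
    have := ler_wpM2l (ltW p0) m1; lra.
  rewrite (negbTE Hx) if_same; case: ifP => // ?; exfalso; lra.
Qed.

Lemma Parseval : \sum_(k <- int_range n) sqn (c k) @[n --> \oo] --> 2 * pi * N2 v.
Proof.
apply/cvgrPdist_lt => e e0; have [_ H] := circ_complete.
have [l hl] := H _ (divr_gt0 e0 p0).
pose N := \max_(p <- l) `|p.2|%N.
exists N.+1 => // n /= Nn.
have := best_approximation (uniq_int_range n) (l := l).
have := Bessel (uniq_int_range n).
rewrite -subr_ge0 => h1 h2; rewrite ger0_norm//; apply: (le_lt_trans (h2 _)).
  move=> p pl; apply: mem_int_range; apply: leq_trans Nn; rewrite ltnS.
  by rewrite /N; exact: (leq_bigmax_seq _ pl).
by rewrite ltr_pdivlMr// mulrC in hl.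
Qed.

End Parseval.
End FourierSeries.

(** * The Plancherel identity *)

Section PlancherelTheorem.
Context {R : realType}.
Implicit Types (f g h u v : R -> R[i]) (z w : R[i]).
Local Notation mu := (@lebesgue_measure R).
Local Notation Re := (@complex.Re R).
Local Notation Im := (@complex.Im R).

Let p0 : 0 < 2 * pi :> R. Proof. by rewrite mulr_gt0 ?pi_gt0. Qed.

Section Energy.
Variable F : R -> R.
Hypotheses (mF : measurable_fun [set: R] F) (F0 : forall x, 0 <= F x).

Definition energy (c d : R) : \bar R := (\int[mu]_x (\1_(`]c, d]%classic) x * F x)%:E)%E.

Lemma measurable_energy (c d : R) :
  measurable_fun [set: R] (fun x => (\1_(`]c, d]%classic) x * F x)%:E).
Proof.
apply/measurable_EFinP; apply: measurable_funM => //.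
Qed.

Lemma energy_split (c e d : R) : c <= e -> e <= d ->
  (energy c d = energy c e + energy e d)%E.
Proof.
move=> ce ed; rewrite /energy -ge0_integralD//; try exact: measurable_energy.
- apply: eq_integral => x _; rewrite -EFinD -mulrDl !indic_itv; congr (_ * _)%:E.
  by case: (ltP c x); case: (leP x d); case: (leP x e) => /= *; rewrite ?addr0 ?add0r//; exfalso; lra.
- by move=> x _; rewrite lee_fin mulr_ge0.
- by move=> x _; rewrite lee_fin mulr_ge0.
Qed.

Lemma energy_unit (k : R) :
  energy k (k + 1) = (\int[mu]_x (\1_(`]0, 1]%classic) x * F (x + k))%:E)%E.
Proof.
rewrite /energy (@ge0_integral_affine _ 1 (- k) ltr01) ?mul1e.
- apply: eq_integral => x _; rewrite mul1r opprK !indic_itv; congr (_ * _)%:E.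
  by rewrite -{1}(add0r k) ltrD2r (addrC k) lerD2r.
- exact: measurable_energy.
- by move=> x; rewrite lee_fin mulr_ge0.
Qed.

Lemma energy_sum (c : R) (m : nat) :
  (energy c (c + m%:R) = \sum_(0 <= i < m) energy (c + i%:R) (c + i%:R + 1)%R)%E.
Proof.
elim: m => [|m IH].
  rewrite big_geq// addr0 /energy (_ : (fun x => _) = cst 0%E) ?integral0//.
  apply/funext => x; rewrite indic_itv; case: ifP => [|_]; last by rewrite mul0r.
  by move=> ?; exfalso; lra.
rewrite big_nat_recr//= -IH -natr1 addrA; apply: energy_split.
  by rewrite lerDl ler0n.
by rewrite lerDl.
Qed.

Lemma energy_cvg : energy (- n%:R) n%:R @[n --> \oo] --> (\int[mu]_x (F x)%:E)%E.
Proof.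
rewrite (_ : (\int[mu]_x (F x)%:E)%E =
  (\int[mu]_x (limn (fun n : nat => (\1_(`](- n%:R)%R, n%:R]%classic) x * F x)%:E)))%E).
  apply: cvg_monotone_convergence => //.
  - by move=> n; exact: measurable_energy.
  - by move=> n x _; rewrite lee_fin mulr_ge0.
  - move=> x _ n m nm; rewrite lee_fin ler_wpM2r// !indic_itv.
    have : n%:R <= m%:R :> R by rewrite ler_nat.
    by case: ifP => h1; case: ifP => h2 ?; rewrite ?ler01//; exfalso; lra.
apply: eq_integral => x _; apply/esym/cvg_lim => //.
have [N HN] : exists N : nat, `|x| < N%:R.
  by exists (Num.bound `|x|); exact: archi_boundP.
apply: cvg_near_cst; exists N => // n /= Nn.
rewrite indic_itv; have : N%:R <= n%:R :> R by rewrite ler_nat.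
move: HN; rewrite ltr_norml; case: ifP; rewrite ?mul1r// => h1 h2 h3; exfalso; lra.
Qed.

End Energy.

Section Base.
Variable u : R -> R[i].
Hypothesis u2 : L2 u.
Hypothesis u_supp : forall x, ~ `]0, 2 * pi]%classic x -> u x = 0.

Let iu : cintegrable u. Proof. exact: cintegrable_supp u2 u_supp. Qed.
Let ut (t x : R) : R[i] := cis (- t * x) * u x.
Let ut2 t : L2 (ut t).
Proof. by apply: L2_unit; [exact: cmeas_cisl|by move=> x; exact: sqn_cis|]. Qed.

(** The values of the Fourier integral of u along t + Z are the Fourier
    coefficients of u modulated by t. *)
Lemma fourier1_coef (k : int) (t : R) :
  fourier1 u (t + k%:~R) = dotL2 (ut t) (circ_char k).
Proof.
rewrite /fourier1 /dotL2; congr cintegral; apply/funext => x.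
have [xJ|xJ] := pselect (`]0, 2 * pi]%classic x); last first.
  by rewrite /ut u_supp// mulr0 !mul0r.
rewrite /ut /circ_char /expk cindE mem_set// mulr1 -cisN.
by rewrite mulrDl opprD cisD -mulNr; ring.
Qed.

Let F x := sqn (fourier1 u x).
Let mF : measurable_fun [set: R] F.
Proof. by apply: measurable_sqn; exact: cmeas_fourier1. Qed.
Let F0 x : 0 <= F x. Proof. exact: sqn_ge0. Qed.

Let S n t := \sum_(k <- int_range n) F (t + k%:~R).

Let SE n t : S n t = \sum_(k <- int_range n) sqn (dotL2 (ut t) (circ_char k)).
Proof. by apply: eq_bigr => k _; rewrite /F fourier1_coef. Qed.

Lemma energy_S n : energy F (- n%:R) n%:R = (\int[mu]_t (\1_(`]0, 1]%classic) t * S n t)%:E)%E.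
Proof.
have -> : energy F (- n%:R) n%:R = energy F (- n%:R) (- n%:R + (2 * n)%:R).
  by congr energy; rewrite natrM; ring.
rewrite energy_sum//.
under eq_bigr do rewrite energy_unit//.
rewrite -ge0_integral_sum//.
- apply: eq_integral => t _; rewrite sumEFin; congr EFin.
  rewrite /S /int_range big_map mulr_sumr /index_iota subn0.
  by apply: eq_bigr => i _; rewrite intrB addrC (addrC _ t) (addrC i%:~R).
- move=> i; apply/measurable_EFinP; apply: measurable_funM.
    by apply: measurable_indic; exact: measurable_itv.
  apply: (measurableT_comp mF); apply: measurable_funD => //; exact: measurable_cst.
- by move=> i t _; rewrite lee_fin mulr_ge0.
Qed.

(** By [fourier1_coef] and [Parseval], the sum of |fourier1 u|^2 over t + Z is
    2 pi N2 u for every t; integrating over t in ]0, 1] gives the integral over the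
    line. *)
Lemma Plancherel_circle : (\int[mu]_x (F x)%:E = (2 * pi * N2 u)%:E)%E.
Proof.
have N2ut t : N2 (ut t) = N2 u.
  by rewrite /ut N2_unit// => x; exact: sqn_cis.
have ut_supp t x : ~ `]0, 2 * pi]%classic x -> ut t x = 0.
  by move=> /u_supp ux; rewrite /ut ux mulr0.
have Scv t : S n t @[n --> \oo] --> 2 * pi * N2 u.
  rewrite -(N2ut t); under eq_fun do rewrite SE.
  exact: (Parseval (ut2 t) (ut_supp t)).
have Sle n t : S n t <= 2 * pi * N2 u.
  by rewrite -(N2ut t) SE; apply: Bessel => //; exact: uniq_int_range.
have S0 n t : 0 <= S n t by apply: sumr_ge0.
have mS n : measurable_fun [set: R] (S n).
  apply: measurable_sum => k; apply: (measurableT_comp mF).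
  by apply: measurable_funD => //; exact: measurable_cst.
have mI : measurable_fun [set: R] (\1_(`]0, 1]%classic) : R -> R).
  by apply: measurable_indic; exact: measurable_itv.
have iI : mu.-integrable [set: R] (EFin \o (fun x => \1_(`]0, 1]%classic) x : R)).
  have /L2P[_] := @L2_itv R 0 1.
  by under eq_fun do rewrite sqn_cind.
have := @dominated_convergence _ _ _ mu [set: R] measurableT
  (fun n t => (\1_(`]0, 1]%classic) t * S n t)%:E)
  (fun t => (\1_(`]0, 1]%classic) t * (2 * pi * N2 u))%:E)
  (fun t => ((2 * pi * N2 u) * \1_(`]0, 1]%classic) t)%:E).
case.
- move=> n; apply/measurable_EFinP.
  exact: (measurable_funM mI (mS n)).
- by apply/measurable_EFinP; apply: measurable_funM.
- apply: aeW => t _; apply: cvg_EFin; first exact: nearW.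
  by apply: cvgM; [exact: cvg_cst|exact: Scv].
- exact: integrableMl.
- apply: aeW => t n _; rewrite /= lee_fin ger0_norm ?mulr_ge0//.
  by rewrite mulrC ler_wpM2r.
move=> _ _ H; have {}H : energy F (- n%:R) n%:R @[n --> \oo] -->
    (\int[mu]_t (\1_(`]0, 1]%classic) t * (2 * pi * N2 u))%:E)%E.
  by under eq_fun do rewrite energy_S; exact: H.
rewrite -(cvg_unique _ H (energy_cvg mF F0))//.
under eq_integral do rewrite mulrC EFinM.
rewrite ge0_integralZl//; last 2 first.
- exact/measurable_EFinP.
- by rewrite lee_fin mulr_ge0 ?N2_ge0 ?ltW.
have mI' : measurable (`]0, 1]%classic : set R) by exact: measurable_itv.
have -> : (\int[mu]_t (\1_(`]0, 1]%classic) t)%:E = mu `]0%R, 1%R]%classic)%E.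
  by rewrite integral_indic// setIT.
by rewrite lebesgue_measure_itv /= lte_fin ltr01 -EFinB subr0 mule1.
Qed.

End Base.

Definition plancherel_identity (u : R -> R[i]) : Prop :=
  (\int[mu]_x (sqn (fourier1 u x))%:E = (2 * pi * N2 u)%:E)%E.

Lemma plancherel_identity_L2 u : cintegrable u -> plancherel_identity u ->
  L2 (fourier1 u) /\ N2 (fourier1 u) = 2 * pi * N2 u.
Proof.
move=> iu pu; have mu_ := cmeas_fourier1 iu; split; last by rewrite /N2 /Rintegral pu.
apply/L2P; split => //; apply/integrableP; split.
  by apply/measurable_EFinP; exact: measurable_sqn.
under eq_integral do rewrite gee0_abs ?lee_fin ?sqn_ge0//.
by rewrite pu ltry.
Qed.

(** A dilation reduces a symmetric interval to ]0, 2 pi]. *)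
Lemma Plancherel_itv (c : R) u : 0 < c -> L2 u ->
  (forall x, ~ `](- (c * pi)), (c * pi)]%classic x -> u x = 0) -> plancherel_identity u.
Proof.
move=> c0 u2 us; have iu := cintegrable_supp u2 us.
have c1 : 0 < c^-1 by rewrite invr_gt0.
have := @Plancherel_circle (dil c (c * pi) u) (L2_dil _ c0 u2).
rewrite (N2_dil _ c0 u2) /plancherel_identity => <-.
  have mF : measurable_fun [set: R] (fun x => (sqn (fourier1 u x))%:E).
    by apply/measurable_EFinP; apply: measurable_sqn; exact: cmeas_fourier1.
  rewrite (@ge0_integral_affine _ c^-1 0 c1 _ mF); last first.
    by move=> x; rewrite lee_fin sqn_ge0.
  rewrite -ge0_integralZl//; last 3 first.
  - apply/measurable_EFinP; apply: (measurable_sqn (f := fun x => fourier1 u (c^-1 * x - 0))).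
    apply: cmeas_comp (cmeas_fourier1 iu).
    by apply: measurable_funB => //; exact: mulrl_measurable.
  - by move=> x _; rewrite lee_fin sqn_ge0.
  - by rewrite lee_fin ltW.
  apply: eq_integral => x _; rewrite fourier1_dil// /fdil sqnM sqn_cis mul1r.
  by rewrite sqn_dil// EFinM.
move=> x xJ; rewrite /dil us ?mulr0// => h; apply: xJ; move: h.
rewrite /= !in_itv /= => /andP[h1 h2]; apply/andP; split.
  by rewrite -(pmulr_rgt0 _ c0); lra.
by rewrite -(ler_pM2l c0); lra.
Qed.

Definition truncation (u : R -> R[i]) (n : nat) (x : R) : R[i] :=
  cind `](- (n.+1%:R * pi)), (n.+1%:R * pi)] x * u x.

Lemma truncation_cvg u x : \forall n \near \oo, truncation u n x = u x.
Proof.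
have [N HN] : exists N : nat, `|x| < N%:R.
  by exists (Num.bound `|x|); exact: archi_boundP.
exists N => // n /= Nn; rewrite /truncation cind_itv.
have : N%:R <= n%:R :> R by rewrite ler_nat.
have n0 : 0 <= n%:R :> R by rewrite ler0n.
have := pi_ge2 R; rewrite -natr1; move: HN; rewrite ltr_norml.
case: ifP; rewrite ?mul1r// => h1 h2 h3 h4; exfalso.
have : n%:R + 1 <= (n%:R + 1) * pi :> R by nra.
by move: h1 h2 h4; rewrite -natr1; lra.
Qed.

Lemma sqn_truncation u n x : sqn (truncation u n x) <= sqn (u x).
Proof.
rewrite /truncation cind_itv; case: ifP => _; rewrite ?mul1r// mul0r sqn0.
exact: sqn_ge0.
Qed.

Section Truncation.
Variable u : R -> R[i].
Hypotheses (iu : cintegrable u) (u2 : L2 u).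
Let v := truncation u.

Lemma L2_truncation n : L2 (v n).
Proof.
apply: (L2_dom (K := 1) _ u2).
  apply: cmeasM; last exact: L2_meas.
  by apply: cmeas_cind; exact: measurable_itv.
by move=> x; rewrite mul1r; exact: sqn_truncation.
Qed.
Let v_supp n x : ~ `](- (n.+1%:R * pi))%R, (n.+1%:R * pi)%R]%classic x -> v n x = 0.
Proof. by move=> xJ; rewrite /v /truncation cindE memNset// mul0r. Qed.

Lemma cintegrable_truncation n : cintegrable (v n).
Proof. exact: cintegrable_supp (L2_truncation n) (@v_supp n). Qed.

Lemma Plancherel_truncation n : plancherel_identity (v n).
Proof. by apply: Plancherel_itv (L2_truncation n) (@v_supp n); rewrite ltr0n. Qed.

Let iv := cintegrable_truncation.
Let pv := Plancherel_truncation.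
Let v2 := L2_truncation.

Lemma N2_truncation : N2 (fun x => v n x - u x) @[n --> \oo] --> (0 : R).
Proof.
apply: (N2_dominated u2) => //.
- by move=> n; exact: L2_meas.
- exact: L2_meas.
- by move=> n x; exact: sqn_truncation.
- apply: aeW => x; apply: cvg_near_cst; apply: filterS (truncation_cvg u x) => n E.
  by rewrite /v E subrr sqn0.
Qed.

Lemma fourier1_truncation xi : sqn (fourier1 (v n) xi) @[n --> \oo] --> sqn (fourier1 u xi).
Proof.
have part (A : R -> R) (B : nat -> R -> R) :
    (forall n, mu.-integrable [set: R] (EFin \o B n)) ->
    mu.-integrable [set: R] (EFin \o A) ->
    (forall x, \forall n \near \oo, B n x = A x) ->
    (forall n x, `|B n x| <= `|Re (u x)| + `|Im (u x)|) ->
    \int[mu]_x B n x @[n --> \oo] --> \int[mu]_x A x.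
  move=> iB iA BA Bd; have := @dominated_convergence _ _ _ mu [set: R] measurableT
    (fun n x => (B n x)%:E) (EFin \o A) (EFin \o (fun x => `|Re (u x)| + `|Im (u x)|)).
  case.
  - by move=> n; have /integrableP[] := iB n.
  - by case/integrableP : iA.
  - apply: aeW => x _; apply: cvg_near_cst; apply: filterS (BA x) => n /= ->//.
  - exact: cintegrable_abs.
  - by apply: aeW => x n _; rewrite /= lee_fin.
  move=> _ _ H; apply: fine_cvg; rewrite -[X in _ --> X]fineK in H; first exact: H.
  by apply: integrable_fin_num.
have H1 : Re (fourier1 (v n) xi) @[n --> \oo] --> Re (fourier1 u xi).
  apply: part.
  - by move=> n; have [] := cintegrable_cis xi (iv n).
  - by have [] := cintegrable_cis xi iu.
  - by move=> x; apply: filterS (truncation_cvg u x) => n E; rewrite /v E.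
  - move=> n x; rewrite /v /truncation cind_itv; case: ifP => _.
      by rewrite mul1r; apply: Re_unit_le; exact: sqn_cis.
    by rewrite !mul0r normr0 addr_ge0.
have H2 : Im (fourier1 (v n) xi) @[n --> \oo] --> Im (fourier1 u xi).
  apply: part.
  - by move=> n; have [] := cintegrable_cis xi (iv n).
  - by have [] := cintegrable_cis xi iu.
  - by move=> x; apply: filterS (truncation_cvg u x) => n E; rewrite /v E.
  - move=> n x; rewrite /v /truncation cind_itv; case: ifP => _.
      by rewrite mul1r; apply: Im_unit_le; exact: sqn_cis.
    by rewrite !mul0r normr0 addr_ge0.
rewrite /sqn; under eq_fun do rewrite !expr2.
by rewrite !expr2; apply: cvgD; exact: cvgM.
Qed.

(** Fatou's lemma along truncations, whose Fourier integrals converge pointwise. *)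
Lemma Plancherel_le : (\int[mu]_x (sqn (fourier1 u x))%:E <= (2 * pi * N2 u)%:E)%E.
Proof.
have mF n : measurable_fun [set: R] (fun x => (sqn (fourier1 (v n) x))%:E).
  by apply/measurable_EFinP; apply: measurable_sqn; exact: cmeas_fourier1.
have := @fatou _ _ _ mu [set: R] measurableT _ mF.
move=> H; have {}H := H (fun n x _ => _ : (0 <= (sqn (fourier1 (v n) x))%:E)%E).
have {}H : (\int[mu]_x (sqn (fourier1 u x))%:E <= limn_einf (fun n => (2 * pi * N2 (v n))%:E))%E.
  apply: (le_trans _ (le_trans (H _) _)).
  - rewrite le_eqVlt; apply/orP; left; apply/eqP; apply: eq_integral => x _.
    have C : (sqn (fourier1 (v n) x))%:E @[n --> \oo] --> (sqn (fourier1 u x))%:E.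
      by apply: cvg_EFin; [exact: nearW|exact: fourier1_truncation].
    by rewrite (cvg_limn_einf_sup C).1.
  - by move=> n x; rewrite lee_fin sqn_ge0.
  - by under eq_fun do rewrite pv.
apply: (le_trans H); have C : (2 * pi * N2 (v n))%:E @[n --> \oo] --> (2 * pi * N2 u)%:E.
  apply: cvg_EFin; first exact: nearW.
  apply: cvgM; first exact: cvg_cst.
  exact: cvg_N2 N2_truncation.
by rewrite (cvg_limn_einf_sup C).1.
Qed.

End Truncation.
End PlancherelTheorem.

(** * The Fourier transform on L^2 *)

Section FourierL2.
Context {R : realType}.
Implicit Types (f g h u v : R -> R[i]) (z w : R[i]).
Local Notation mu := (@lebesgue_measure R).
Local Notation Re := (@complex.Re R).
Local Notation Im := (@complex.Im R).

(** The inequality [Plancherel_le], applied to the differences u - v_n with the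
    truncations v_n, shows that fourier1 v_n tends to fourier1 u in L^2, so the
    identity passes from v_n to u. *)
Theorem Plancherel u : cintegrable u -> L2 u ->
  L2 (fourier1 u) /\ N2 (fourier1 u) = 2 * pi * N2 u.
Proof.
move=> iu u2.
have small (k : R -> R[i]) : cintegrable k -> L2 k ->
    L2 (fourier1 k) /\ N2 (fourier1 k) <= 2 * pi * N2 k.
  move=> iw k2; have le := Plancherel_le iw k2; have mw := cmeas_fourier1 iw.
  have hw2 : L2 (fourier1 k).
    apply/L2P; split => //; apply/integrableP; split.
      by apply/measurable_EFinP; exact: measurable_sqn.
    under eq_integral do rewrite gee0_abs ?lee_fin ?sqn_ge0//.
    by apply: (le_lt_trans le); rewrite ltry.
  by split => //; rewrite -lee_fin -N2E.
have [hu2 _] := small _ iu u2; split => //.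
pose v := truncation u.
have v2 n : L2 (v n) := L2_truncation u2 n.
have iv n : cintegrable (v n) := cintegrable_truncation u2 n.
have pv n : plancherel_identity (v n) := Plancherel_truncation u2 n.
have hv n : L2 (fourier1 (v n)) /\ N2 (fourier1 (v n)) = 2 * pi * N2 (v n).
  exact: plancherel_identity_L2.
have vu := N2_truncation u2.
have C1 : N2 (fourier1 (v n)) @[n --> \oo] --> 2 * pi * N2 u.
  under eq_fun do rewrite (hv _).2.
  by apply: cvgM; [exact: cvg_cst|exact: cvg_N2].
have C2 : N2 (fourier1 (v n)) @[n --> \oo] --> N2 (fourier1 u).
  apply: cvg_N2 => //; first by move=> n; exact: (hv n).1.
  have E n : N2 (fun x => fourier1 (v n) x - fourier1 u x) <= 2 * pi * N2 (fun x => v n x - u x).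
    have iN : cintegrable (fun x => (-1) * u x) by exact: cintegrableZ.
    have -> : (fun x => fourier1 (v n) x - fourier1 u x) =
        fourier1 (fun x => v n x + (-1) * u x).
      by apply/funext => x; rewrite fourier1D// fourier1Z// mulN1r.
    have -> : (fun x => v n x - u x) = fun x => v n x + (-1) * u x.
      by apply/funext => x; rewrite mulN1r.
    by apply: (small _ _ _).2; [exact: cintegrableD|apply: L2D => //; exact: L2Z].
  apply: (squeeze_cvgr (f := fun=> 0) (h := fun n => 2 * pi * N2 (fun x => v n x - u x))).
  - by apply: nearW => n; rewrite N2_ge0 E.
  - exact: cvg_cst.
  - rewrite -[X in _ --> X](mulr0 (2 * pi : R)); apply: cvgM => //; exact: cvg_cst.
exact: (cvg_unique _ C2 C1).
Qed.

Lemma cvgL2D (u v : nat -> R -> R[i]) f g : (forall n, L2 (u n)) -> (forall n, L2 (v n)) ->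
  L2 f -> L2 g -> cvgL2 u f -> cvgL2 v g ->
  cvgL2 (fun n x => u n x + v n x) (fun x => f x + g x).
Proof.
move=> u2 v2 f2 g2 /cvgL2P uf /cvgL2P vg; apply/cvgL2P.
- by move=> n; exact: L2D.
- exact: L2D.
have uf' := uf u2 f2; have vg' := vg v2 g2.
apply: (squeeze_cvgr (f := fun=> 0)
  (h := fun n => 2 * (N2 (fun x => u n x - f x) + N2 (fun x => v n x - g x)))).
- apply: nearW => n; rewrite N2_ge0 /=.
  rewrite (_ : (fun x => _) = fun x => (u n x - f x) + (v n x - g x)).
    by apply: N2D_le; exact: L2B.
  by apply/funext => x; ring.
- exact: cvg_cst.
- have : 2 * (N2 (fun x => u n x - f x) + N2 (fun x => v n x - g x)) @[n --> \oo] -->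
    (2 * (0 + 0) : R) by apply: cvgM; [exact: cvg_cst|exact: cvgD].
  by rewrite addr0 mulr0.
Qed.

Lemma cvgL2_map (T : (R -> R[i]) -> R -> R[i]) (K : R) (u : nat -> R -> R[i]) f :
  (forall g, L2 g -> L2 (T g)) ->
  (forall g, L2 g -> N2 (T g) = K * N2 g) ->
  (forall g h, (fun x => T g x - T h x) = T (fun x => g x - h x)) ->
  (forall n, L2 (u n)) -> L2 f -> cvgL2 u f -> cvgL2 (fun n => T (u n)) (T f).
Proof.
move=> T2 TK TB u2 f2 /cvgL2P uf; apply/cvgL2P; [by move=> n; exact: T2|exact: T2|].
have -> : (fun n => N2 (fun x => T (u n) x - T f x)) =
    fun n => K * N2 (fun x => u n x - f x).
  by apply/funext => n; rewrite TB TK//; exact: L2B.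
rewrite -[X in _ --> X](mulr0 K); apply: cvgM; first exact: cvg_cst.
exact: uf.
Qed.

Lemma is_fourier_isometry f g : is_fourier f g -> N2 g = 2 * pi * N2 f.
Proof.
move=> [f2 g2 [u [u12 uf ug]]].
have u2 n : L2 (u n) by have [] := u12 n.
have iu n : cintegrable (u n) by apply: L1_cintegrable; have [] := u12 n.
have hu n := Plancherel (iu n) (u2 n).
have hu2 n : L2 (fourier1 (u n)) := (hu n).1.
have C1 := cvg_N2 u2 f2 ((cvgL2P u2 f2).1 uf).
have C2 := cvg_N2 hu2 g2 ((cvgL2P hu2 g2).1 ug).
have C3 : N2 (fourier1 (u n)) @[n --> \oo] --> 2 * pi * N2 f.
  under eq_fun do rewrite (hu _).2.
  by apply: cvgM => //; exact: cvg_cst.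
exact: (cvg_unique _ C2 C3).
Qed.

Lemma is_fourierD f g f' g' : is_fourier f g -> is_fourier f' g' ->
  is_fourier (fun x => f x + f' x) (fun x => g x + g' x).
Proof.
move=> [f2 g2 [u [u12 uf ug]]] [f2' g2' [u' [u12' uf' ug']]].
have u2 n : L2 (u n) by have [] := u12 n.
have iu n : cintegrable (u n) by apply: L1_cintegrable; have [] := u12 n.
have u2' n : L2 (u' n) by have [] := u12' n.
have iu' n : cintegrable (u' n) by apply: L1_cintegrable; have [] := u12' n.
have h2 n : L2 (fourier1 (u n)) := (Plancherel (iu n) (u2 n)).1.
have h2' n : L2 (fourier1 (u' n)) := (Plancherel (iu' n) (u2' n)).1.
split; [exact: L2D|exact: L2D|].
exists (fun n x => u n x + u' n x); split.
- by move=> n; split; [apply: cintegrable_L1; exact: cintegrableD|exact: L2D].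
- exact: cvgL2D.
- rewrite (_ : (fun n => _) = fun n xi => fourier1 (u n) xi + fourier1 (u' n) xi).
    exact: cvgL2D.
  by apply/funext => n; apply/funext => xi; rewrite fourier1D.
Qed.

Lemma is_fourierZ c f g : is_fourier f g ->
  is_fourier (fun x => c * f x) (fun x => c * g x).
Proof.
move=> [f2 g2 [u [u12 uf ug]]].
have u2 n : L2 (u n) by have [] := u12 n.
have iu n : cintegrable (u n) by apply: L1_cintegrable; have [] := u12 n.
have h2 n : L2 (fourier1 (u n)) := (Plancherel (iu n) (u2 n)).1.
have map (v : nat -> R -> R[i]) h : (forall n, L2 (v n)) -> L2 h -> cvgL2 v h ->
    cvgL2 (fun n x => c * v n x) (fun x => c * h x).
  apply: (cvgL2_map (T := fun g x => c * g x) (K := sqn c)).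
  - by move=> k; exact: L2Z.
  - by move=> k; exact: N2Z.
  - by move=> k l; apply/funext => x; rewrite mulrBr.
split; [exact: L2Z|exact: L2Z|].
exists (fun n x => c * u n x); split.
- by move=> n; split; [apply: cintegrable_L1; exact: cintegrableZ|exact: L2Z].
- exact: map.
- rewrite (_ : (fun n => _) = fun n xi => c * fourier1 (u n) xi); first exact: map.
  by apply/funext => n; apply/funext => xi; rewrite fourier1Z.
Qed.

Lemma is_fourierB f g f' g' : is_fourier f g -> is_fourier f' g' ->
  is_fourier (fun x => f x - f' x) (fun x => g x - g' x).
Proof.
move=> fg fg'; have := is_fourierD fg (is_fourierZ (-1) fg').
have E (h k : R -> R[i]) : (fun x => h x + (-1) * k x) = fun x => h x - k x.
  by apply/funext => x; rewrite mulN1r.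
by rewrite !E.
Qed.

Lemma is_fourier0 : is_fourier (fun=> 0 : R[i]) (fun=> 0 : R[i]) (R := R).
Proof.
have i0 : cintegrable (fun=> 0 : R[i]) (R := R) by split; exact: integrable0.
split; [exact: L2_0|exact: L2_0|].
have C : cvgL2 (fun=> fun=> 0 : R[i]) (fun=> 0 : R[i]) (R := R).
  apply/cvgL2P; [by move=> _; exact: L2_0|exact: L2_0|].
  by under eq_fun do (under [X in N2 X]eq_fun do rewrite subrr); rewrite N2_0; exact: cvg_cst.
exists (fun=> fun=> 0); split => //.
  by move=> n; split; [exact: cintegrable_L1|exact: L2_0].
rewrite (_ : (fun n => _) = fun=> fun=> 0)//; apply/funext => n; apply/funext => xi.
transitivity (fourier1 (fun x => 0 * (fun=> 0 : R[i]) x) xi).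
  by congr fourier1; apply/funext => x; rewrite mul0r.
by rewrite fourier1Z// mul0r.
Qed.

Lemma is_fourier_sum (I : Type) (s : seq I) (F G : I -> R -> R[i]) :
  (forall i, is_fourier (F i) (G i)) ->
  is_fourier (fun x => \sum_(i <- s) F i x) (fun x => \sum_(i <- s) G i x).
Proof.
move=> FG; elim: s => [|i s IH].
  have E (H : I -> R -> R[i]) : (fun x => \sum_(i <- [::]) H i x) = fun=> 0.
    by apply/funext => x; rewrite big_nil.
  by rewrite !E; exact: is_fourier0.
have E (H : I -> R -> R[i]) : (fun x => \sum_(j <- i :: s) H j x) =
    fun x => H i x + \sum_(j <- s) H j x by apply/funext => x; rewrite big_cons.
by rewrite !E; exact: is_fourierD.
Qed.

Lemma is_fourier_dil a b f g : 0 < a -> is_fourier f g ->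
  is_fourier (dil a b f) (fdil a b g).
Proof.
move=> a0 [f2 g2 [u [u12 uf ug]]].
have u2 n : L2 (u n) by have [] := u12 n.
have iu n : cintegrable (u n) by apply: L1_cintegrable; have [] := u12 n.
have h2 n : L2 (fourier1 (u n)) := (Plancherel (iu n) (u2 n)).1.
split; [exact: L2_dil|exact: L2_fdil|].
exists (fun n => dil a b (u n)); split.
- by move=> n; split; [apply: cintegrable_L1; exact: cintegrable_dil|exact: L2_dil].
- apply: (cvgL2_map (K := 1)) => //.
  + by move=> k; exact: L2_dil.
  + by move=> k k2; rewrite mul1r N2_dil.
  + by move=> k l; apply/funext => x; rewrite /dil mulrBr.
- rewrite (_ : (fun n => _) = fun n => fdil a b (fourier1 (u n))).
    apply: (cvgL2_map (K := 1)) => //.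
    + by move=> k; exact: L2_fdil.
    + by move=> k k2; rewrite mul1r N2_fdil.
    + by move=> k l; apply/funext => x; rewrite /fdil /dil -!mulrBr.
  by apply/funext => n; apply/funext => xi; rewrite fourier1_dil.
Qed.

Lemma is_fourier_ae f g g' : is_fourier f g -> cmeas g' -> {ae mu, forall x, g x = g' x} ->
  is_fourier f g'.
Proof.
move=> [f2 g2 [u [u12 uf ug]]] mg' gg'.
have [g2' N0] := ae_eq_N2 g2 mg' gg'.
have u2 n : L2 (u n) by have [] := u12 n.
have iu n : cintegrable (u n) by apply: L1_cintegrable; have [] := u12 n.
have h2 n : L2 (fourier1 (u n)) := (Plancherel (iu n) (u2 n)).1.
split => //; exists u; split => //.
have C : cvgL2 (fun _ x => g x - g x) (fun x => g' x - g x).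
  apply/cvgL2P; [by move=> _; exact: L2B|exact: L2B|].
  rewrite (_ : (fun=> _) = fun=> 0); first exact: cvg_cst.
  apply/funext => n; rewrite -N0; congr N2; apply/funext => x; ring.
have := cvgL2D h2 (fun _ => L2B g2 g2) g2 (L2B g2' g2) ug C.
rewrite (_ : (fun x => g x + _) = g'); last by apply/funext => x; ring.
rewrite (_ : (fun n x => _) = fun n => fourier1 (u n))//.
by apply/funext => n; apply/funext => x; ring.
Qed.

(** Polarization of [is_fourier_isometry]; the imaginary part is reached by
    multiplying one argument by i. *)
Lemma is_fourier_dot f g f' g' : is_fourier f g -> is_fourier f' g' ->
  dotL2 g g' = (2 * pi)%:C * dotL2 f f'.
Proof.
move=> fg fg'; have [f2 g2 _] := fg; have [f2' g2' _] := fg'.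
have ReE h h' k k' : is_fourier h k -> is_fourier h' k' ->
    Re (dotL2 k k') = 2 * pi * Re (dotL2 h h').
  move=> hk hk'; have [h2 k2 _] := hk; have [h2' k2' _] := hk'.
  have := is_fourier_isometry (is_fourierD hk hk').
  by rewrite N2D// N2D// (is_fourier_isometry hk) (is_fourier_isometry hk'); lra.
have Re_iM z : Re (conjc 'i%C * z) = Im z by rewrite ReM /= mul0r sub0r mulN1r opprK.
have ImE (h h' : R -> R[i]) : L2 h -> L2 h' ->
    Im (dotL2 h h') = Re (dotL2 h (fun x => 'i%C * h' x)).
  by move=> h2 h2'; rewrite dotZr// Re_iM.
have Im_realM (t : R) z : Im (t%:C * z) = t * Im z by rewrite ImM /= mul0r addr0.
apply: complex_ext; first by rewrite ReM /= mul0r subr0; exact: ReE.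
rewrite Im_realM !ImE//; apply: ReE => //; exact: is_fourierZ.
Qed.

End FourierL2.

(** * The Fourier transform of the wavelet *)

Section Profile.
Context {R : realType}.
Variable r : nat.
Implicit Types (f g h u v : R -> R[i]) (z w : R[i]).
Local Notation mu := (@lebesgue_measure R).

(* A stands for 2^(r+1), so that Q = A pi lies in the lattice 2 pi Z, and alA makes
   I_r = [2 al, 2 pi] and J_r = [Q, Q + 2 al]. With these letters all inequalities
   between the points of the construction are linear. *)
Variables (A Q al s : R).
Hypotheses (A4 : 4 <= A) (QE : Q = A * pi) (alA : 2 * al * A = Q + 2 * al).
Hypothesis sE : s = (Num.sqrt 2)^-1.

Let A10 : A - 1 != 0. Proof. by apply/eqP => h; have := A4; lra. Qed.
Let p0 : 0 < pi :> R. Proof. exact: pi_gt0. Qed.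
Let Q4 : 4 * pi <= Q. Proof. by rewrite QE ler_wpM2r ?A4// ltW. Qed.
Let al_bounds : pi / 2 < al /\ al < pi.
Proof.
have E : (2 * al - pi) * (A - 1) = pi by move: alA; rewrite QE; lra.
have E2 : (2 * pi - 2 * al) * (A - 1) = pi * (A - 2) by move: alA; rewrite QE; lra.
have B1 : 0 < A - 1 by have := A4; lra.
have h1 : 0 < 2 * al - pi by rewrite -(pmulr_lgt0 _ B1) E.
have h2 : 0 < 2 * pi - 2 * al by rewrite -(pmulr_lgt0 _ B1) E2 mulr_gt0//; have := A4; lra.
by split; lra.
Qed.
Let al1 : pi / 2 < al. Proof. exact: al_bounds.1. Qed.
Let al2 : al < pi. Proof. exact: al_bounds.2. Qed.
Lemma geometry : [/\ 0 < pi :> R, 4 * pi <= Q, pi / 2 < al & al < pi].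
Proof. by split. Qed.
Let s0 : 0 < s. Proof. by rewrite sE invr_gt0 sqrtr_gt0. Qed.
Let ss : s * s = 2^-1. Proof. by rewrite sE -invfM -expr2 sqr_sqrtr. Qed.

Definition step (c d x : R) : R := if c < x <= d then 1 else 0.

Lemma step_cind c d x : (step c d x)%:C = cind `]c, d] x.
Proof. by rewrite cind_itv /step; case: ifP. Qed.

(** The function psi_hat with half-open intervals instead of closed ones: the
    two agree off the finite set [endpoints], hence as elements of L^2. *)
Definition profile (x : R) : R :=
  step Q (Q + al) x + s * step (Q + al) (Q + pi) x + step (Q + pi) (Q + 2 * al) x
  + s * step al pi x + s * step (2 * al) (2 * pi) x
  - s * step (2 * Q + 2 * al) (2 * Q + 2 * pi) x.

Definition endpoints : seq R := [:: al; 2 * al; Q; Q + al; 2 * Q + 2 * al].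

Lemma affsetE (c a : R) (S : set R) x : c != 0 -> (x \in affset c S a) = ((x - a) / c \in S).
Proof.
move=> c0; apply/idP/idP; rewrite !inE.
  by move=> [y Sy <-]; rewrite addrK mulrC mulKf.
by move=> Sx; exists ((x - a) / c) => //; rewrite mulrC divfK// subrK.
Qed.

(** This identifies the left end of I_r, 2^(r+1) pi / (2^(r+1) - 1), as 2 al. *)
Lemma in_I x : A = 2 ^+ r.+1 -> (x \in I_ r) = (2 * al <= x <= 2 * pi).
Proof.
move=> AE; rewrite /I_ mem_setE in_itv /= -AE (_ : A / (A - 1) * pi = 2 * al)//.
rewrite mulrAC -QE; apply/(canLR (mulfK A10)); rewrite mulrBr mulr1 alA; ring.
Qed.

Lemma in_J x : A = 2 ^+ r.+1 -> (x \in J_ r) = (Q <= x <= Q + 2 * al).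
Proof.
move=> AE; rewrite /J_ mem_setE in_itv /= -AE -QE (_ : _ / (A - 1) * pi = Q + 2 * al)//.
have -> : (2 * r + 2 = r.+1 + r.+1)%N by lia.
rewrite exprD -AE; clear AE; rewrite mulrAC -(mulrA A) -QE; apply/(canLR (mulfK A10)).
have : Q * (A - 1) + A * pi = Q * A by rewrite -QE; ring.
by move: alA; lra.
Qed.

Ltac decide_if := try match goal with
  | |- context [if ?b then _ else _] =>
      first [ (have -> : b = false by lra) | (have -> : b = true by lra) ]
  end.

(** Case analysis on the position of y: the parameters are the values of the profile
    and of its six steps, and each case carries linear inequalities, so that
    inconsistent combinations are refuted by [lra]. *)
Variant profile_spec (y : R) : R -> R -> R -> R -> R -> R -> R -> Prop :=
  | ProfileZero of y <= al \/ pi < y <= 2 * al \/ 2 * pi < y <= Q \/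
        Q + 2 * al < y <= 2 * Q + 2 * al \/ 2 * Q + 2 * pi < y : profile_spec y 0 0 0 0 0 0 0
  | ProfileH of al < y <= pi : profile_spec y s 0 0 0 1 0 0
  | ProfileI of 2 * al < y <= 2 * pi : profile_spec y s 0 0 0 0 1 0
  | ProfileJ1 of Q < y <= Q + al : profile_spec y 1 1 0 0 0 0 0
  | ProfileJ2 of Q + al < y <= Q + pi : profile_spec y s 0 1 0 0 0 0
  | ProfileJ3 of Q + pi < y <= Q + 2 * al : profile_spec y 1 0 0 1 0 0 0
  | ProfileI2 of 2 * Q + 2 * al < y <= 2 * Q + 2 * pi : profile_spec y (- s) 0 0 0 0 0 1.

Lemma profileP y : profile_spec y (profile y)
  (step Q (Q + al) y) (step (Q + al) (Q + pi) y) (step (Q + pi) (Q + 2 * al) y)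
  (step al pi y) (step (2 * al) (2 * pi) y) (step (2 * Q + 2 * al) (2 * Q + 2 * pi) y).
Proof.
have [pi0 Qge alge alle] := geometry.
have simp01 := (mulr0, mulr1, addr0, add0r, subr0, sub0r).
have cut c : y <= c \/ c < y by case: (leP y c); [left|right].
have c1 := cut al; have c2 := cut pi; have c3 := cut (2 * al).
have c4 := cut (2 * pi); have c5 := cut Q; have c6 := cut (Q + al).
have c7 := cut (Q + pi); have c8 := cut (Q + 2 * al).
have c9 := cut (2 * Q + 2 * al); have c10 := cut (2 * Q + 2 * pi); clear cut.
rewrite /profile /step.
case: c1 => c1.
  by clear c2 c3 c4 c5 c6 c7 c8 c9 c10; do 6 decide_if; rewrite !simp01; constructor; left.
case: c2 => c2.
  by clear c3 c4 c5 c6 c7 c8 c9 c10; do 6 decide_if; rewrite !simp01; constructor; lra.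
clear c1; case: c3 => c3.
  by clear c4 c5 c6 c7 c8 c9 c10; do 6 decide_if; rewrite !simp01; constructor; lra.
clear c2; case: c4 => c4.
  by clear c5 c6 c7 c8 c9 c10; do 6 decide_if; rewrite !simp01; constructor; lra.
clear c3; case: c5 => c5.
  by clear c6 c7 c8 c9 c10; do 6 decide_if; rewrite !simp01; constructor; lra.
clear c4; case: c6 => c6.
  by clear c7 c8 c9 c10; do 6 decide_if; rewrite !simp01; constructor; lra.
clear c5; case: c7 => c7.
  by clear c8 c9 c10; do 6 decide_if; rewrite !simp01; constructor; lra.
clear c6; case: c8 => c8.
  by clear c9 c10; do 6 decide_if; rewrite !simp01; constructor; lra.
clear c7; case: c9 => c9.
  by clear c10; do 6 decide_if; rewrite !simp01; constructor; lra.
clear c8; case: c10 => c10.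
  by do 6 decide_if; rewrite !simp01; constructor; lra.
by do 6 decide_if; rewrite !simp01; constructor; lra.
Qed.

Lemma psi_hat_profile x : A = 2 ^+ r.+1 -> x \notin endpoints -> psi_hat r x = (profile x)%:C.
Proof.
move=> AE xe; rewrite /psi_hat !in_setU in_setD !affsetE ?invr_neq0 ?oner_neq0//.
rewrite !(in_I _ AE) (in_J _ AE) subr0 invrK divr1 -sE (exprS _ r.+1) -AE -mulrA -QE.
clear AE; have [pi0 Qge alge alle] := geometry.
have lt c : c \in endpoints -> x <= c -> x < c.
  by move=> ce xc; rewrite lt_neqAle xc andbT; apply: contraNneq xe => ->.
have [l1 l2 l3 l4 l5] : [/\ x <= al -> x < al, x <= 2 * al -> x < 2 * al, x <= Q -> x < Q,
    x <= Q + al -> x < Q + al & x <= 2 * Q + 2 * al -> x < 2 * Q + 2 * al].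
  by split; apply: lt; rewrite !inE eqxx ?orbT.
clear lt xe; case: (profileP x) => hx.
- have {hx l1 l2 l3 l4 l5}hx : x < al \/ pi < x < 2 * al \/ 2 * pi < x < Q \/
      Q + 2 * al < x < 2 * Q + 2 * al \/ 2 * Q + 2 * pi < x.
    case: hx => [/l1|[/andP[? /l2 ?]|[/andP[? /l3 ?]|[/andP[? /l5 ?]|?]]]]; lra.
  by rewrite !ifF//; case: hx => [|[|[|[|]]]] ?; lra.
- by clear l1 l2 l3 l4 l5; rewrite ifT//; lra.
- by clear l1 l2 l3 l4 l5; rewrite ifT//; lra.
- have {l4} : x < Q + al by apply: l4; lra.
  by clear l1 l2 l3 l5 => lt; rewrite ifF; [rewrite ifF; [rewrite ifT//|]|]; lra.
- by clear l1 l2 l3 l4 l5; rewrite ifT//; lra.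
- by clear l1 l2 l3 l4 l5; rewrite ifF; [rewrite ifF; [rewrite ifT//|]|]; lra.
- by clear l1 l2 l3 l4 l5; rewrite ifF; [rewrite ifT//|]; lra.
Qed.

(** Two adjacent scales interact only on I_r and on I_r + 2 Q, and with opposite
    signs: this is what the minus sign in psi_hat is for. *)
Lemma profile_half x : profile x * profile (x / 2) =
  2^-1 * (step (2 * al) (2 * pi) x - step (2 * Q + 2 * al) (2 * Q + 2 * pi) x).
Proof.
have [pi0 Qge alge alle] := geometry; rewrite /step.
case: (profileP (x / 2)) => hy.
- rewrite mulr0.
  have -> : (2 * al < x <= 2 * pi) = false by lra.
  have -> : (2 * Q + 2 * al < x <= 2 * Q + 2 * pi) = false by lra.
  by rewrite subrr mulr0.
- have -> : (2 * al < x <= 2 * pi) = true by lra.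
  have -> : (2 * Q + 2 * al < x <= 2 * Q + 2 * pi) = false by lra.
  by rewrite subr0 mulr1 -ss; case: (profileP x) => // hx; exfalso; lra.
- have -> : (2 * al < x <= 2 * pi) = false by lra.
  have -> : (2 * Q + 2 * al < x <= 2 * Q + 2 * pi) = false by lra.
  by rewrite subrr mulr0; case: (profileP x) => hx; rewrite ?mul0r//; exfalso; lra.
- have -> : (2 * al < x <= 2 * pi) = false by lra.
  have -> : (2 * Q + 2 * al < x <= 2 * Q + 2 * pi) = false by lra.
  by rewrite subrr mulr0; case: (profileP x) => hx; rewrite ?mul0r//; exfalso; lra.
- have -> : (2 * al < x <= 2 * pi) = false by lra.
  have -> : (2 * Q + 2 * al < x <= 2 * Q + 2 * pi) = true by lra.
  by rewrite sub0r mulrN1 -ss -mulNr; case: (profileP x) => // hx; exfalso; lra.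
- have -> : (2 * al < x <= 2 * pi) = false by lra.
  have -> : (2 * Q + 2 * al < x <= 2 * Q + 2 * pi) = false by lra.
  by rewrite subrr mulr0; case: (profileP x) => hx; rewrite ?mul0r//; exfalso; lra.
- have -> : (2 * al < x <= 2 * pi) = false by lra.
  have -> : (2 * Q + 2 * al < x <= 2 * Q + 2 * pi) = false by lra.
  by rewrite subrr mulr0; case: (profileP x) => hx; rewrite ?mul0r//; exfalso; lra.
Qed.

Lemma profile_sqr x : profile x ^+ 2 =
  step Q (Q + al) x + 2^-1 * step (Q + al) (Q + pi) x + step (Q + pi) (Q + 2 * al) x
  + 2^-1 * step al pi x + 2^-1 * step (2 * al) (2 * pi) x
  + 2^-1 * step (2 * Q + 2 * al) (2 * Q + 2 * pi) x.
Proof.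
have simp01 := (mulr0, mulr1, addr0, add0r).
by case: (profileP x) => _; rewrite !simp01 expr2 ?mulrNN ?ss ?mulr0 ?mulr1.
Qed.

(** Scales at distance d >= 2 have disjoint supports. The support lies in the
    three bands ]al, 2 pi], ]Q, Q + 2 al] and ]2 Q + 2 al, 2 Q + 2 pi]; a dilation by
    2^d moves the two upper bands past 2 Q + 2 pi. The lower one becomes
    ]2^d al, 2^d pi] and ]2^d 2 al, 2^d 2 pi], and where these lie among the bands
    depends on whether 2^d is at most A / 2, equal to A, equal to 2 A, or larger. *)
Lemma profile_far x (d : nat) : A = 2 ^+ r.+1 -> (2 <= d)%N ->
  profile x * profile (x / 2 ^+ d) = 0.
Proof.
move=> AE d2; have [pi0 Qge alge alle] := geometry.
set p : R := 2 ^+ d; have p4 : 4 <= p.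
  rewrite /p -(subnK d2) exprD; have : 1 <= 2 ^+ (d - 2) :> R by rewrite exprn_ege1// ler1n.
  by lra.
have pow (i j : nat) : (i <= j)%N -> 2 ^+ i <= 2 ^+ j :> R.
  by move=> ij; rewrite ler_weXn2l// ler1n.
have pos : 0 < p by lra.
have alt : p <= A / 2 \/ p = A \/ p = 2 * A \/ 4 * A <= p.
  have [dr|rd] := leqP d r.
    left; rewrite AE exprS; have := pow _ _ dr; rewrite -/p; lra.
  have [E|n1] := eqVneq d r.+1; first by right; left; rewrite /p E AE.
  have [E|n2] := eqVneq d r.+2; first by right; right; left; rewrite /p E AE -exprS.
  right; right; right; have : (r.+3 <= d)%N by lia.
  by move=> /pow; rewrite -/p AE !exprS; lra.
have Z4 : 4 * Q <= p * Q by rewrite ler_wpM2r//; lra.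
have B4 := A4; have al0 : 0 <= al by lra.
have QA : A * pi = Q by rewrite QE.
have XY : [\/ 4 * al <= p * al /\ p * pi <= Q / 2,
    p * al = (Q + 2 * al) / 2 /\ p * pi = Q,
    p * al = Q + 2 * al /\ p * pi = 2 * Q | 2 * Q + 4 * al <= p * al].
  have alA' := alA.
  case: alt => [h|[->|[->|h]]].
  - constructor 1; split; first by rewrite ler_wpM2r.
    by have := ler_wpM2r (ltW pi0) h; lra.
  - by constructor 2; split; lra.
  - by constructor 3; split; lra.
  - constructor 4; have := ler_wpM2r al0 h; lra.
have xE : x = p * (x / p) by rewrite mulrC divfK// gt_eqF.
set y := x / p in xE *; clearbody y; clear alt pow p4 AE B4 QA.
have Hy : [\/ profile y = 0, p * al < x /\ x <= p * pi,
    2 * (p * al) < x /\ x <= 2 * (p * pi) | p * Q < x].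
  have gt (c : R) : c < y -> p * c < x by move=> ?; rewrite xE ltr_pM2l.
  have le (c : R) : y <= c -> x <= p * c by move=> ?; rewrite xE ler_pM2l.
  case: (profileP y) => hy; first by constructor 1.
  - by constructor 2; case/andP: hy => /gt ? /le.
  - by constructor 3; case/andP: hy => /gt ? /le ?; split; lra.
  - by constructor 4; apply: gt; lra.
  - by constructor 4; apply: gt; lra.
  - by constructor 4; apply: gt; lra.
  - by constructor 4; apply: gt; lra.
have Hx : [\/ profile x = 0, x <= 2 * pi, Q < x /\ x <= Q + 2 * al |
    2 * Q + 2 * al < x /\ x <= 2 * Q + 2 * pi].
  case: (profileP x) => hx; first by constructor 1.
  - by constructor 2; lra.
  - by constructor 2; lra.
  - by constructor 3; lra.
  - by constructor 3; lra.
  - by constructor 3; lra.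
  - by constructor 4; lra.
move: (p * al) (p * pi) (p * Q) XY Z4 Hy => X Y Z XY Z4 Hy; clear xE.
case: Hx => [->|hx|hx|hx]; first by rewrite mul0r.
- case: Hy => [->|hy|hy|hy]; rewrite ?mulr0//; exfalso; case: XY; lra.
- case: Hy => [->|hy|hy|hy]; rewrite ?mulr0//; exfalso; case: XY; lra.
- case: Hy => [->|hy|hy|hy]; rewrite ?mulr0//; exfalso; case: XY; lra.
Qed.

End Profile.

(** * Completeness *)

Section Completeness.
Context {R : realType}.
Variable r : nat.
Implicit Types (f g h u v : R -> R[i]) (z w : R[i]).
Local Notation mu := (@lebesgue_measure R).
Variables (A Q al s : R).
Hypotheses (A4 : 4 <= A) (QE : Q = A * pi) (alA : 2 * al * A = Q + 2 * al).
Hypothesis sE : s = (Num.sqrt 2)^-1.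
Hypothesis AE : A = 2 ^+ r.+1.
Local Notation profile := (profile Q al s).

Let geometry := geometry A4 QE alA.

(** The integer part of a point, in units of the period 2 pi, is unique. *)
Lemma circ_index (y : R) (m M : int) : 0 < y < 2 * pi ->
  2 * pi * M%:~R < y + 2 * pi * m%:~R <= 2 * pi * M%:~R + 2 * pi -> m = M.
Proof.
move=> y02 h; have p0 := pi_gt0 R.
have [mM|mM|//] := ltgtP m M.
  have : m%:~R + 1 <= M%:~R :> R by rewrite -(intrD _ m 1) ler_int; lia.
  move: (m%:~R : R) (M%:~R : R) h => a b h ab; exfalso.
  have : 2 * pi * (a + 1) <= 2 * pi * b by rewrite ler_wpM2l//; lra.
  lra.
have : M%:~R + 1 <= m%:~R :> R by rewrite -(intrD _ M 1) ler_int; lia.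
move: (m%:~R : R) (M%:~R : R) h => a b h ab; exfalso.
have : 2 * pi * (b + 1) <= 2 * pi * a by rewrite ler_wpM2l//; lra.
lra.
Qed.

Lemma cind_circ (c d y : R) (m M : int) : 0 <= c -> d <= 2 * pi ->
  0 < y < 2 * pi -> y != d ->
  cind `]c + 2 * pi * M%:~R, d + 2 * pi * M%:~R] (y + 2 * pi * m%:~R) =
  if (m == M) && (c < y < d) then 1 else 0.
Proof.
move=> c0 d2 y02 yd; rewrite cind_itv.
have [->|mM] := eqVneq m M.
  by rewrite ltrD2r lerD2r (le_eqVlt y) (negbTE yd).
case: ifP => // h; exfalso; move/eqP: mM; apply.
by apply: (circ_index y02); lra.
Qed.

(** Q in units of the period: translations by Q and 2 Q stay in the fibres of the
    circle, which is why the bands of the profile interact. *)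
Definition half_turns : int := (2 ^ r)%:Z.
Lemma Q_turns : Q = 2 * pi * half_turns%:~R.
Proof. by rewrite QE AE exprS /half_turns -pmulrn natrX; ring. Qed.
Lemma Q_turns2 : 2 * Q = 2 * pi * (2 * half_turns)%:~R.
Proof. by rewrite Q_turns intrM; ring. Qed.

Lemma profile_supp x : profile x != 0 ->
  [\/ 0 < x <= 2 * pi, Q < x <= Q + 2 * pi | 2 * Q < x <= 2 * Q + 2 * pi].
Proof.
have [pi0 Qge alge alle] := geometry.
case: (profileP s A4 QE alA x) => hx; rewrite ?eqxx// => _.
- by constructor 1; lra.
- by constructor 1; lra.
- by constructor 2; lra.
- by constructor 2; lra.
- by constructor 2; lra.
- by constructor 3; lra.
Qed.

Section Span.
(* M plays the role of the closed span of the wavelets on the Fourier side: it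
   contains the integer modulations of the profile and is stable under dyadic
   dilations. *)
Variable M : (R -> R[i]) -> Prop.
Hypothesis clM : closed_subspace M.
Hypothesis profile2 : L2 (fun x => (profile x)%:C).
Hypothesis Mprofile : forall k, M (fun x => (profile x)%:C * expk k x).
Hypothesis Mdil : forall f (j : int), M f -> M (dil (2 ^ j) 0 f).

(** Above the arc ]c, d[ the fibre meets the support of the profile in the three
    points y, y + Q and y + 2 Q only. When the profile has constant values w0, w1, w2
    there, [cs_arc] puts the corresponding combination of indicators in M. *)
Lemma cs_fiber (c d w0 w1 w2 : R) : 0 <= c -> c < d -> d <= 2 * pi ->
  (forall y, c < y < d -> [/\ profile y = w0, profile (y + Q) = w1 & profile (y + 2 * Q) = w2]) ->
  M (fun x => w0%:C * cind `]c, d] x + w1%:C * cind `]c + Q, d + Q] x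
     + w2%:C * cind `]c + 2 * Q, d + 2 * Q] x).
Proof.
move=> c0 cd d2 H.
have mi (l u : R) : cmeas (cind `]l, u]) := L2_meas (L2_itv l u).
apply: (cs_arc clM profile2 Mprofile c0 cd d2).
  by apply: cmeasD; first apply: cmeasD; (apply: cmeasM; [exact: cmeas_cst|exact: mi]).
move=> y m y02 yc yd.
have E0 : cind `]c, d] (y + 2 * pi * m%:~R) = if (m == 0) && (c < y < d) then 1 else 0.
  by rewrite -(cind_circ m 0 c0 d2 y02 yd) mulr0 !addr0.
have E1 : cind `]c + Q, d + Q] (y + 2 * pi * m%:~R) =
    if (m == half_turns) && (c < y < d) then 1 else 0.
  by rewrite Q_turns; exact: cind_circ.
have E2 : cind `]c + 2 * Q, d + 2 * Q] (y + 2 * pi * m%:~R) =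
    if (m == 2 * half_turns) && (c < y < d) then 1 else 0.
  by rewrite Q_turns2; exact: cind_circ.
rewrite E0 E1 E2; clear E0 E1 E2.
have N0 : half_turns != 0 by rewrite /half_turns eqz_nat expn_eq0.
have N01 : (0 == half_turns) = false by rewrite eq_sym (negbTE N0).
have N02 : (0 == 2 * half_turns) = false by rewrite eq_sym mulf_eq0 (negbTE N0).
have N12 : (half_turns == 2 * half_turns) = false.
  by rewrite -[X in X == _]mul1r (inj_eq (mulIf N0)).
case: ifPn => [/andP[/eqP -> hy]|hm].
  rewrite hy N01 N02 /= !mulr0 !addr0 mulr1.
  by have [-> _ _] := H y hy.
case: (boolP (c < y < d)) hm => hy; last by rewrite !andbF !mulr0 !addr0.
rewrite !andbT => m0; have [E1 E2 E3] := H y hy.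
have [->|mN] := eqVneq m half_turns.
  by rewrite -Q_turns E2 N12 mulr1 !mulr0 add0r addr0.
have [->|m2N] := eqVneq m (2 * half_turns).
  by rewrite -Q_turns2 E3 mulr1 !mulr0 !add0r.
rewrite !mulr0 !addr0; have [->//|/profile_supp] := eqVneq (profile (y + 2 * pi * m%:~R)) 0.
case => h; exfalso.
- by move/eqP: m0; apply; apply: (circ_index y02); rewrite mulr0 add0r.
- by move/eqP: mN; apply; apply: (circ_index y02); rewrite -Q_turns.
- by move/eqP: m2N; apply; apply: (circ_index y02); rewrite -Q_turns2.
Qed.

Definition fills (l u : R) : Prop :=
  forall f, L2 f -> (forall x, ~~ (l < x <= u) -> f x = 0) -> M f.

Lemma fills_ind (l u : R) : l <= u ->
  (forall c d, l <= c -> c < d -> d <= u -> M (cind `]c, d])) -> fills l u.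
Proof.
move=> lu H f f2 f0; apply: (cs_full clM lu _ f2).
  move=> c d lc cd du; have [E|ne] := eqVneq c d; last by apply: H => //; rewrite lt_neqAle ne.
  rewrite E (_ : cind _ = fun=> 0); first exact: cs0 clM.
  by apply/funext => x; rewrite cind_itv; case: ifP => // ?; exfalso; lra.
by move=> x; rewrite /= in_itv /= => /negP; exact: f0.
Qed.

Lemma L2_cut f (l u : R) : L2 f -> L2 (fun x => cind `]l, u] x * f x).
Proof.
move=> f2; apply: (L2Mb (K := 1)) => //; first exact: L2_meas (L2_itv l u).
by move=> x; rewrite sqn_cind indic_itv; case: ifP.
Qed.

Lemma fills_join (l m u : R) : l <= m -> m <= u -> fills l m -> fills m u -> fills l u.
Proof.
move=> lm mu_ H1 H2 f f2 f0.
rewrite (_ : f = fun x => cind `]l, m] x * f x + cind `]m, u] x * f x).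
  apply: (csD clM).
    by apply: H1; [exact: L2_cut|move=> x h; rewrite cind_itv (negbTE h) mul0r].
  by apply: H2; [exact: L2_cut|move=> x h; rewrite cind_itv (negbTE h) mul0r].
apply/funext => x; rewrite !cind_itv.
have [h|h] := boolP (l < x <= u); last by rewrite f0// !mulr0 addr0.
have [h1|h1] : x <= m \/ m < x by case: (leP x m); [left|right].
  have -> : (l < x <= m) = true by lra.
  have -> : (m < x <= u) = false by lra.
  by rewrite mul1r mul0r addr0.
have -> : (l < x <= m) = false by lra.
have -> : (m < x <= u) = true by lra.
by rewrite mul0r mul1r add0r.
Qed.

Let two_gt0 (j : int) : 0 < 2 ^ j :> R. Proof. by rewrite exprz_gt0. Qed.

Lemma fills_dil (l u : R) (j : int) : fills l u -> fills (2 ^ j * l) (2 ^ j * u).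
Proof.
move=> H f f2 f0; have j0 := two_gt0 j.
have NE : 2 ^ (- j) * 2 ^ j = 1 :> R by rewrite -expfzDr// addNr.
have -> : f = dil (2 ^ (- j)) 0 (dil (2 ^ j) 0 f).
  apply/funext => x; rewrite /dil !subr0 mulrA -rmorphM -sqrtrM ?ltW//.
  by rewrite NE sqrtr1 mul1r mulrA (mulrC (2 ^ j)) NE mul1r.
apply: Mdil; apply: H; first exact: L2_dil.
move=> x h; rewrite /dil subr0 f0 ?mulr0//.
by rewrite ltr_pM2l// ler_pM2l.
Qed.

(** Here y + Q is the only point of the fibre in the support. *)
Lemma fills_J1 : fills Q (Q + al).
Proof.
have [pi0 Qge alge alle] := geometry.
apply: fills_ind; first lra.
move=> c d lc cd du; have := @cs_fiber (c - Q) (d - Q) 0 1 0.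
rewrite !subrK => H.
rewrite (_ : cind _ = fun x => 0%:C * cind `]c - Q, d - Q] x + 1%:C * cind `]c, d] x +
  0%:C * cind `]c - Q + 2 * Q, d - Q + 2 * Q] x); last first.
  by apply/funext => x; rewrite !mul0r mul1r add0r addr0.
apply: H; [lra|lra|lra|].
move=> y hy; split.
- by case: (profileP s A4 QE alA y) => // h; exfalso; lra.
- by case: (profileP s A4 QE alA (y + Q)) => // h; exfalso; lra.
- by case: (profileP s A4 QE alA (y + 2 * Q)) => // h; exfalso; lra.
Qed.

Lemma fills_J3 : fills (Q + pi) (Q + 2 * al).
Proof.
have [pi0 Qge alge alle] := geometry.
apply: fills_ind; first lra.
move=> c d lc cd du; have := @cs_fiber (c - Q) (d - Q) 0 1 0.
rewrite !subrK => H.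
rewrite (_ : cind _ = fun x => 0%:C * cind `]c - Q, d - Q] x + 1%:C * cind `]c, d] x +
  0%:C * cind `]c - Q + 2 * Q, d - Q + 2 * Q] x); last first.
  by apply/funext => x; rewrite !mul0r mul1r add0r addr0.
apply: H; [lra|lra|lra|].
move=> y hy; split.
- by case: (profileP s A4 QE alA y) => // h; exfalso; lra.
- by case: (profileP s A4 QE alA (y + Q)) => // h; exfalso; lra.
- by case: (profileP s A4 QE alA (y + 2 * Q)) => // h; exfalso; lra.
Qed.

(** Up to constant factors, over ]2 al, 2 pi] the fibres give 1_E - 1_(E + 2 Q) for
    E = ]c, d]. Over the half E / 2, inside ]al, pi], they give
    1_(E / 2) + 1_(E / 2 + Q), whose dilate by 2 is 1_E + 1_(E + 2 Q). The two
    combinations are independent, so both indicators lie in M. *)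
Lemma M_I (c d : R) : 2 * al <= c -> c < d -> d <= 2 * pi ->
  M (cind `]c, d]) /\ M (cind `]c + 2 * Q, d + 2 * Q]).
Proof.
have [pi0 Qge alge alle] := geometry.
move=> lc cd du.
have s0 : 0 < s by rewrite sE invr_gt0 sqrtr_gt0.
have H1 : M (fun x => s%:C * cind `]c / 2, d / 2] x + s%:C * cind `]c / 2 + Q, d / 2 + Q] x +
    0%:C * cind `]c / 2 + 2 * Q, d / 2 + 2 * Q] x).
  apply: cs_fiber; [lra|lra|lra|] => y hy; split.
  - by case: (profileP s A4 QE alA y) => // h; exfalso; lra.
  - by case: (profileP s A4 QE alA (y + Q)) => // h; exfalso; lra.
  - by case: (profileP s A4 QE alA (y + 2 * Q)) => // h; exfalso; lra.
have H2 : M (fun x => s%:C * cind `]c, d] x + 0%:C * cind `]c + Q, d + Q] x +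
    (- s)%:C * cind `]c + 2 * Q, d + 2 * Q] x).
  apply: cs_fiber; [lra|lra|lra|] => y hy; split.
  - by case: (profileP s A4 QE alA y) => // h; exfalso; lra.
  - by case: (profileP s A4 QE alA (y + Q)) => // h; exfalso; lra.
  - by case: (profileP s A4 QE alA (y + 2 * Q)) => // h; exfalso; lra.
have {}H1 := Mdil (-1) H1; pose t : R := Num.sqrt (2 ^ (-1)).
have t0 : t%:C != 0 :> R[i] by rewrite fmorph_eq0 gt_eqF// sqrtr_gt0.
have sC0 : s%:C != 0 :> R[i] by rewrite fmorph_eq0 gt_eqF.
have H3 : M (fun x => s%:C * cind `]c, d] x + s%:C * cind `]c + 2 * Q, d + 2 * Q] x).
  have := csZ clM (t%:C)^-1 H1.
  rewrite (_ : (fun x => _) = fun x => s%:C * cind `]c, d] x + s%:C * cind `]c + 2 * Q, d + 2 * Q] x)//.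
  apply/funext => x; rewrite /dil -/t mulKf// subr0 mul0r addr0.
  have E (a b : R) : cind `]a / 2, b / 2] (2 ^ (-1) * x) = cind `]a, b] x.
    rewrite !cind_itv (_ : 2 ^ (-1) * x = x / 2); last by rewrite mulrC.
    by rewrite ltr_pM2r// ler_pM2r.
  rewrite E (_ : c / 2 + Q = (c + 2 * Q) / 2); last by field.
  by rewrite (_ : d / 2 + Q = (d + 2 * Q) / 2) ?E//; field.
split.
  have := csZ clM (2 * s%:C)^-1 (csD clM H2 H3).
  rewrite (_ : (fun x => _) = cind `]c, d])//; apply/funext => x.
  by rewrite rmorphN; field.
have := csZ clM (2 * s%:C)^-1 (csB clM H3 H2).
rewrite (_ : (fun x => _) = cind `]c + 2 * Q, d + 2 * Q])//; apply/funext => x.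
by rewrite rmorphN; field.
Qed.

Lemma fills_I : fills (2 * al) (2 * pi).
Proof.
have [pi0 Qge alge alle] := geometry.
apply: fills_ind; first lra.
by move=> c d lc cd du; have [] := M_I lc cd du.
Qed.

(** A dilate by 1/2 of the interval ]2 Q + 2 al, 2 Q + 2 pi] handled by [M_I]. *)
Lemma fills_J2 : fills (Q + al) (Q + pi).
Proof.
have [pi0 Qge alge alle] := geometry.
have H : fills (2 * Q + 2 * al) (2 * Q + 2 * pi).
  apply: fills_ind; first lra.
  move=> c d lc cd du; have [|||_] := @M_I (c - 2 * Q) (d - 2 * Q); [lra|lra|lra|].
  by rewrite !subrK.
have := @fills_dil _ _ (-1) H.
rewrite (_ : 2 ^ (-1) * _ = Q + al).
  by rewrite (_ : 2 ^ (-1) * _ = Q + pi)// (_ : 2 ^ (-1) = 2^-1 :> R)//; field.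
by rewrite (_ : 2 ^ (-1) = 2^-1 :> R)//; field.
Qed.

(** The octave ]Q, 2 Q] is covered by J_r, cut at Q + al and Q + pi, and by
    A ]2 al, 2 pi] = ]Q + 2 al, 2 Q]; the octave itself is the dilate by A of ]pi, 2 pi]. *)
Lemma fills_octave : fills pi (2 * pi).
Proof.
have [pi0 Qge alge alle] := geometry.
have AI : fills (Q + 2 * al) (2 * Q).
  have := @fills_dil _ _ (Posz r.+1) fills_I.
  rewrite (_ : 2 ^ (Posz r.+1) = A :> R) ?AE// -AE.
  rewrite mulrC alA (_ : A * (2 * pi) = 2 * Q)// QE; ring.
have H : fills Q (2 * Q).
  apply: (@fills_join _ (Q + al)); [lra|lra|exact: fills_J1|].
  apply: (@fills_join _ (Q + pi)); [lra|lra|exact: fills_J2|].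
  by apply: (@fills_join _ (Q + 2 * al)); [lra|lra|exact: fills_J3|].
have := @fills_dil _ _ (- Posz r.+1) H.
have An0 : A != 0 by have := A4; case: eqVneq => // ->; lra.
have EA : 2 ^ (- Posz r.+1) = A^-1 :> R by rewrite AE exprnN.
by rewrite EA (mulrCA _ 2) QE mulKf.
Qed.

Lemma fills_octaves (n : nat) : fills (2 ^ (- n%:Z) * pi) (2 ^ n%:Z * pi).
Proof.
have p0 := pi_gt0 R.
elim: n => [|n IH].
  move=> f f2 f0; rewrite (_ : f = fun=> 0); first exact: cs0 clM.
  apply/funext => x; apply: f0; rewrite oppr0 expr0z mul1r.
  by apply/negP => ?; lra.
have step (j : int) : fills (2 ^ j * pi) (2 ^ (j + 1) * pi).
  by have := @fills_dil _ _ j fills_octave; rewrite expfzDr// expr1z mulrA.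
have mono (j : int) : 2 ^ j * pi <= 2 ^ (j + 1) * pi :> R.
  rewrite ler_wpM2r ?ltW// expfzDr// expr1z; have := two_gt0 j; lra.
have E1 : (- n.+1%:Z + 1 = - n%:Z)%R by lia.
have E2 : (n%:Z + 1 = n.+1%:Z)%R by lia.
have mid (k : nat) : 2 ^ (- k%:Z) * pi <= 2 ^ k%:Z * pi :> R.
  apply: ler_wpM2r; first exact: ltW.
  by rewrite ler_eXz2l ?ltr1n//; lia.
apply: (@fills_join _ (2 ^ (- n%:Z) * pi)).
- by rewrite -E1; exact: mono.
- by apply: (le_trans (mid n)); rewrite -E2; exact: mono.
- by rewrite -E1; exact: step.
- apply: (@fills_join _ (2 ^ n%:Z * pi)) => //; rewrite -E2; [exact: mono|exact: step].
Qed.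

Theorem wavelets_complete f : L2 f -> (forall x, x <= 0 -> f x = 0) -> M f.
Proof.
move=> f2 f0; have p0 := pi_gt0 R; have p2 := pi_ge2 R.
apply: (cs_dom clM (u := fun n x => cind `]2 ^ (- n%:Z) * pi, 2 ^ n%:Z * pi] x * f x) (g := f)) => //.
- move=> n; apply: (@fills_octaves n); first exact: L2_cut.
  by move=> x h; rewrite cind_itv (negbTE h) mul0r.
- exact: L2_meas.
- move=> n x; rewrite cind_itv; case: ifP => _; rewrite ?mul1r// mul0r sqn0.
  exact: sqn_ge0.
apply: aeW => x; apply: cvg_near_cst.
have [x0|x0] := leP x 0; first by apply: nearW => n; rewrite f0// mulr0 subrr sqn0.
have [N HN] : exists N : nat, x + pi / x < N%:R.
  by exists (Num.bound (x + pi / x)); apply: archi_boundP; rewrite addr_ge0 ?divr_ge0 ?ltW.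
exists N => // n /= Nn.
have px : 0 < pi / x by rewrite divr_gt0.
have N2 : N%:R <= 2 ^ n%:Z :> R.
  rewrite -exprnP -natrX ler_nat; apply: (leq_trans Nn); exact/ltnW/ltn_expl.
have n0 := two_gt0 n%:Z.
rewrite cind_itv (_ : _ && _ = true) ?mul1r ?subrr ?sqn0//.
apply/andP; split; last by nra.
have lt : pi < 2 ^ n%:Z * x by rewrite -ltr_pdivrMr//; apply: lt_le_trans N2; lra.
by rewrite -invr_expz mulrC ltr_pdivrMr// mulrC.
Qed.

End Span.
End Completeness.

(** * Orthonormality *)

(** The Fourier transform of [dyadic f jk] when g is that of f. *)
Definition dyadic_hat (R : realType) (g : R -> R[i]) (jk : int * int) : R -> R[i] :=
  fdil (2 ^ jk.1) jk.2%:~R g.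

Section Wavelets.
Context {R : realType}.
Variable r : nat.
Implicit Types (f g h u v : R -> R[i]) (z w : R[i]).
Local Notation mu := (@lebesgue_measure R).
Variables (A Q al s : R).
Hypotheses (A4 : 4 <= A) (QE : Q = A * pi) (alA : 2 * al * A = Q + 2 * al).
Hypothesis sE : s = (Num.sqrt 2)^-1.
Hypothesis AE : A = 2 ^+ r.+1.
Local Notation profile := (profile Q al s).
Local Notation g0 := (fun x => (profile x)%:C).

Local Notation wavelet_hat := (dyadic_hat g0).

Let geometry := geometry A4 QE alA.

Lemma cintegral_chints (l : seq (R[i] * (R * R))) (t : R) :
  cintegral (fun x => \sum_(p <- l) p.1 * (cind `]p.2.1, p.2.2] x * cis (t * x))) =
  \sum_(p <- l) p.1 * chint p.2.1 p.2.2 t.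
Proof.
suff [_ //] : cintegrable (fun x => \sum_(p <- l) p.1 * (cind `]p.2.1, p.2.2] x * cis (t * x))) /\
  cintegral (fun x => \sum_(p <- l) p.1 * (cind `]p.2.1, p.2.2] x * cis (t * x))) =
  \sum_(p <- l) p.1 * chint p.2.1 p.2.2 t.
elim: l => [|p l [IHi IHE]].
  under eq_fun do rewrite big_nil.
  split; first by apply: L1_cintegrable; apply: cintegrable_L1; split; exact: integrable0.
  by rewrite big_nil /cintegral /= !Rintegral_cst// !mul0r.
under eq_fun do rewrite big_cons.
have i1 : cintegrable (fun x => p.1 * (cind `]p.2.1, p.2.2] x * cis (t * x))).
  by apply: cintegrableZ; exact: cintegrable_chint.
split; first exact: cintegrableD.
by rewrite cintegralD// IHE big_cons cintegralZ//; exact: cintegrable_chint.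
Qed.

Lemma L2_profile : L2 g0.
Proof.
have st (c d : R) : L2 (fun x => (step c d x)%:C).
  rewrite (_ : (fun x => _) = cind `]c, d]); first exact: L2_itv.
  by apply/funext => x; rewrite step_cind.
rewrite (_ : g0 = fun x => ((((((step Q (Q + al) x)%:C
  + s%:C * (step (Q + al) (Q + pi) x)%:C) + (step (Q + pi) (Q + 2 * al) x)%:C)
  + s%:C * (step al pi x)%:C) + s%:C * (step (2 * al) (2 * pi) x)%:C)
  - s%:C * (step (2 * Q + 2 * al) (2 * Q + 2 * pi) x)%:C)).
  by apply: L2B; [do ?[apply: L2D => //]|]; exact: L2Z.
by apply/funext => x; rewrite /profile rmorphB !rmorphD !rmorphM.
Qed.

Lemma dil_dil (b c : R) f : 0 < b -> dil b 0 (dil c 0 f) = dil (b * c) 0 f.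
Proof.
move=> b0; apply/funext => x; rewrite /dil !subr0 sqrtrM; last exact: ltW.
by rewrite rmorphM -!mulrA (mulrCA c).
Qed.

(** The Fourier transforms at scale 0; those at scale j are their dilates
    ([wavelet_hatE]), so every inner product reduces to one with scale 0. *)
Definition modulated (k : int) (x : R) : R[i] := expk (- k) x * (profile x)%:C.

Let two_gt0 (j : int) : 0 < 2 ^ j :> R. Proof. by rewrite exprz_gt0. Qed.

Lemma L2_modulated k : L2 (modulated k).
Proof.
by apply: L2_unit; [exact: cmeas_expk|move=> x; exact: sqn_cis|exact: L2_profile].
Qed.

Lemma L2_wavelet_hat jk : L2 (wavelet_hat jk).
Proof. by apply: L2_fdil => //; exact: L2_profile. Qed.

Lemma wavelet_hatE j k : wavelet_hat (j, k) = dil (2 ^ (- j)) 0 (modulated k).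
Proof.
apply/funext => x; rewrite /dyadic_hat /fdil /dil /modulated /expk !subr0 /= invr_expz.
rewrite mulrCA; congr (_ * (cis _ * _)).
rewrite -invr_expz intrN; ring.
Qed.

(** The product is |profile|^2 times a character of period 2 pi. Translating the
    bands back by Q and 2 Q leaves the integral unchanged and gives total weight 1
    on ]0, 2 pi]: 1 on ]0, al] and ]pi, 2 al], and 1/2 + 1/2 on ]al, pi] and
    ]2 al, 2 pi]. *)
Lemma dot_modulated k l : dotL2 (modulated k) (modulated l) = if k == l then (2 * pi)%:C else 0.
Proof.
have [pi0 Qge alge alle] := geometry.
pose t : R := (l - k)%:~R.
pose c : R[i] := (2^-1)%:C.
transitivity (cintegral (fun x => \sum_(p <- [:: (1 : R[i], (Q, Q + al)); (c, (Q + al, Q + pi));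
    (1 : R[i], (Q + pi, Q + 2 * al)); (c, (al, pi)); (c, (2 * al, 2 * pi));
    (c, (2 * Q + 2 * al, 2 * Q + 2 * pi))]) p.1 * (cind `]p.2.1, p.2.2] x * cis (t * x)))).
  rewrite /dotL2; congr cintegral; apply/funext => x.
  have -> : modulated k x * conjc (modulated l x) = (profile x ^+ 2)%:C * cis (t * x).
    rewrite /modulated conjM (_ : conjc (profile x)%:C = (profile x)%:C); last first.
      by apply: complex_ext; rewrite /= ?oppr0.
    rewrite /expk -cisN (_ : t * x = (- k)%:~R * x + - ((- l)%:~R * x)) ?cisD.
      by rewrite rmorphXn /=; ring.
    by rewrite /t intrB !intrN; ring.
  rewrite (profile_sqr A4 QE alA sE) !(rmorphD, rmorphM) /= !step_cind.
  by rewrite !big_cons big_nil /= -/c; ring.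
rewrite cintegral_chints !big_cons big_nil /= addr0 !mul1r.
have N1 (m : int) : cis (t * (2 * pi * m%:~R)) = 1.
  by rewrite /t mulrCA -intrM cis_int.
have sh (a b h : R) (m : int) : h = 2 * pi * m%:~R -> chint (h + a) (h + b) t = chint a b t.
  by move=> hE; rewrite ![h + _]addrC chint_shift hE N1 mul1r.
have QN := Q_turns QE AE; have QN2 := Q_turns2 QE AE.
rewrite -{1}(addr0 Q) !(sh _ _ _ _ QN) !(sh _ _ _ _ QN2).
transitivity (chint 0 (2 * pi) t).
  rewrite (@chint_split _ 0 al (2 * pi)); [|lra|lra].
  rewrite (@chint_split _ al pi (2 * pi)); [|lra|lra].
  rewrite (@chint_split _ pi (2 * al) (2 * pi)); [|lra|lra].
  have cc : c + c = 1 by rewrite /c -rmorphD -(rmorph1 (real_complex R)); congr _%:C; lra.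
  move: (chint 0 al t) (chint al pi t) (chint pi _ t) (chint (2 * al) _ t) => a b e d.
  rewrite -[in RHS](mul1r b) -[in RHS](mul1r d) -cc; ring.
by rewrite /t chint_circle subr_eq0 eq_sym.
Qed.

(** For d >= 2 the supports are disjoint. For d = 1 the product is a character of
    period 4 pi on I_r minus the same on I_r + 2 Q; as 2 Q is a multiple of 4 pi, the
    two integrals cancel. *)
Lemma dot_modulated_dil k l (d : nat) : (0 < d)%N ->
  dotL2 (modulated k) (dil (2 ^ (- d%:Z)) 0 (modulated l)) = 0.
Proof.
move=> d0; have [pi0 Qge alge alle] := geometry.
have E2 x : 2 ^ (- d%:Z) * x = x / 2 ^+ d :> R by rewrite mulrC exprnN.
pose q : R[i] := (Num.sqrt (2 ^ (- d%:Z)))%:C.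
pose t : R := - k%:~R + l%:~R / 2 ^+ d.
have E x : modulated k x * conjc (dil (2 ^ (- d%:Z)) 0 (modulated l) x) =
    q * ((profile x * profile (x / 2 ^+ d))%:C * cis (t * x)).
  have RJ (a : R) : conjc a%:C = a%:C by apply: complex_ext; rewrite /= ?oppr0.
  rewrite /dil subr0 E2 -/q /modulated !conjM !RJ.
  rewrite /expk -cisN (_ : t * x = (- k)%:~R * x + - ((- l)%:~R * (x / 2 ^+ d))) ?cisD.
    by rewrite rmorphM /=; ring.
  by rewrite /t !intrN; ring.
rewrite /dotL2 (_ : (fun x => _) = fun x => q * ((profile x * profile (x / 2 ^+ d))%:C * cis (t * x)));
  last by apply/funext.
have [d2|d1] := leqP 2 d.
  rewrite (_ : (fun x => _) = fun=> 0).
    by rewrite /cintegral /= !Rintegral_cst// !mul0r.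
  by apply/funext => x; rewrite (profile_far A4 QE alA sE x AE d2) mul0r mulr0.
have dE : d = 1 by lia.
subst d; rewrite expr1 in t E *.
pose c : R[i] := q * (2^-1)%:C.
transitivity (cintegral (fun x => \sum_(p <- [:: (c, (2 * al, 2 * pi));
    (- c, (2 * Q + 2 * al, 2 * Q + 2 * pi))]) p.1 * (cind `]p.2.1, p.2.2] x * cis (t * x)))).
  congr cintegral; apply/funext => x.
  rewrite (profile_half A4 QE alA sE) rmorphM rmorphB /= !step_cind.
  by rewrite !big_cons big_nil /= /c; ring.
rewrite cintegral_chints !big_cons big_nil /= addr0.
rewrite ![2 * Q + _]addrC chint_shift (_ : cis _ = 1) ?mul1r ?mulNr ?subrr//.
rewrite (Q_turns QE AE) (_ : t * _ = 2 * pi * ((l - k - k) * half_turns r)%:~R) ?cis_int//.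
by rewrite /t intrM !intrB; field.
Qed.

Lemma dot_wavelet_hat i i' :
  dotL2 (wavelet_hat i) (wavelet_hat i') = if i == i' then (2 * pi)%:C else 0.
Proof.
have up j k j' l : (j < j')%R -> dotL2 (wavelet_hat (j, k)) (wavelet_hat (j', l)) = 0.
  move=> jj'; rewrite !wavelet_hatE.
  have [d d0 dE] : exists2 d : nat, (0 < d)%N & j' = j + d%:Z.
    by exists `|j' - j|%N; lia.
  rewrite dE opprD expfzDr// -dil_dil// dot_dil//; first exact: dot_modulated_dil.
    exact: L2_modulated.
  by apply: L2_dil => //; exact: L2_modulated.
case: i i' => j k [j' l]; have [jj'|jj'|<-] := ltgtP j j'.
- by rewrite up// xpair_eqE lt_eqF.
- rewrite dotC ?up//; try exact: L2_wavelet_hat.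
  by rewrite xpair_eqE gt_eqF//= oppr0.
rewrite !wavelet_hatE dot_dil//; try exact: L2_modulated.
by rewrite dot_modulated xpair_eqE eqxx.
Qed.

(** The closed span is stable under dyadic dilations because these permute the
    family and are isometries. *)
Lemma wavelet_hat_span f : L2 f -> (forall x, x <= 0 -> f x = 0) -> clspan wavelet_hat f.
Proof.
have clM := clspan_closed_subspace L2_wavelet_hat.
apply: (wavelets_complete A4 QE alA sE AE clM L2_profile).
  move=> k; rewrite [X in clspan _ X](_ : _ = wavelet_hat (0, - k)).
    by apply: clspan_e; exact: L2_wavelet_hat.
  apply/funext => x; rewrite wavelet_hatE oppr0 expr0z /dil sqrtr1 subr0 !mul1r.
  by rewrite /modulated opprK mulrC.
move=> f' j [f2 H]; split; first exact: L2_dil.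
move=> eps eps0; have [l lE] := H _ eps0.
exists [seq (p.1, (p.2.1 - j, p.2.2)) | p <- l].
rewrite (_ : (fun x => _) = dil (2 ^ j) 0 (fun x => f' x - comb wavelet_hat l x)).
  by rewrite N2_dil//; apply: L2B => //; apply: L2_comb; exact: L2_wavelet_hat.
apply/funext => x; rewrite /dil subr0 mulrBr; congr (_ - _).
rewrite /comb big_map mulr_sumr; apply: eq_bigr => -[c [j' k]] _.
rewrite [RHS]mulrCA; congr (_ * _).
rewrite !wavelet_hatE opprB expfzDr// -dil_dil//.
by rewrite [LHS]/dil subr0.
Qed.

End Wavelets.

(** * Transfer to the Hardy space *)

Section HardyWavelet.
Context {R : realType}.
Implicit Types (f g : R -> R[i]).
Local Notation mu := (@lebesgue_measure R).

Lemma dyadic_dil f (jk : int * int) : dyadic f jk = dil (2 ^ jk.1) jk.2%:~R f.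
Proof.
apply/funext => x; rewrite /dyadic /dil; congr (_%:C * _).
by rewrite powRrM powR12_sqrt ?powR_ge0// powR_intmul.
Qed.

(** By Plancherel and polarization, orthonormality and density may be verified for
    the Fourier transforms, in the space of functions that vanish on the negative
    half-line. *)
Lemma wavelet_from_fourier (psi g : R -> R[i]) :
  is_fourier psi g -> (forall x, x <= 0 -> g x = 0) ->
  (forall i i', dotL2 (dyadic_hat g i) (dyadic_hat g i') = if i == i' then (2 * pi)%:C else 0) ->
  (forall f, L2 f -> (forall x, x <= 0 -> f x = 0) -> clspan (dyadic_hat g) f) ->
  H2_wavelet psi.
Proof.
move=> Fpsi g0 orth compl; have p0 := pi_gt0 R.
have two_gt0 (j : int) : 0 < 2 ^ j :> R by rewrite exprz_gt0.
pose E := dyadic_hat g.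
have FE i : is_fourier (dyadic psi i) (E i) by rewrite dyadic_dil; exact: is_fourier_dil.
have L2e i : L2 (dyadic psi i) by have [] := FE i.
split.
  by split; [case: Fpsi|exists g => //; exact: aeW].
split.
- move=> i; split; first exact: L2e.
  exists (E i) => //; apply: aeW => x x0.
  by rewrite /E /dyadic_hat /fdil /dil g0 ?mulr0// subr0 pmulr_rle0// invr_gt0.
- move=> i i'; have := is_fourier_dot (FE i) (FE i').
  have pC : (2 * pi)%:C != 0 :> R[i] by rewrite fmorph_eq0 gt_eqF// mulr_gt0.
  rewrite orth; case: eqP => _ h; apply: (mulfI pC); rewrite -h ?mulr1// mulr0//.
- move=> f [f2 [h Fh h0]] eps eps0.
  have h2 : L2 h by case: Fh.
  (* h vanishes on the half-line only almost everywhere *)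
  pose h' x := cind `]0, +oo[ x * h x.
  have mh' : cmeas h' by apply: cmeasM; [exact: cmeas_cind|exact: L2_meas].
  have hh' : {ae mu, forall x, h x = h' x}.
    apply: aeS h0 => x; rewrite /h' cindE mem_setE in_itv /= andbT.
    by case: (ltP 0 x) => x0 H; rewrite ?mul1r// H// mul0r.
  have Fh' := is_fourier_ae Fh mh' hh'.
  have h'2 : L2 h' by case: Fh'.
  have [|_ app] := compl h' h'2.
    by move=> x x0; rewrite /h' cindE mem_setE in_itv /= andbT ltNge x0 mul0r.
  have e1 : 0 < 2 * pi * eps ^+ 2 by rewrite !mulr_gt0// exprn_gt0.
  have [l lE] := app _ e1.
  pose t := undup [seq p.2 | p <- l]; pose c i := \sum_(p <- l | p.2 == i) p.1.
  have lt p : p \in l -> p.2 \in t by move=> pl; rewrite mem_undup map_f.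
  have Es : comb E l = fun x => \sum_(i <- t) c i * E i x by apply: comb_uniq => //; exact: undup_uniq.
  exists t, c.
  have Fd := is_fourierB Fh' (is_fourier_sum t (fun i => is_fourierZ (c i) (FE i))).
  have d2 : L2 (fun x => f x - \sum_(i <- t) c i * dyadic psi i x) by case: Fd.
  have NE := is_fourier_isometry Fd; rewrite -/E Es in lE.
  rewrite cLnormE// lte_fin -[X in _ < X]ger0_norm ?ltW// -sqrtr_sqr ltr_sqrt ?exprn_gt0//.
  by rewrite -(ltr_pM2l (x := 2 * pi)) ?mulr_gt0// -NE.
Qed.

End HardyWavelet.

Theorem theorem3 (R : realType) (r : nat) (hr : (1 <= r)%N)
    (psi : R -> R[i]) (hpsi : is_fourier psi (psi_hat r)) :
  H2_wavelet psi.
Proof.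
pose A : R := 2 ^+ r.+1; pose Q : R := A * pi.
pose al : R := A / (2 * (A - 1)) * pi; pose s : R := (Num.sqrt 2)^-1.
have A4 : 4 <= A.
  have := @ler_weXn2l R 2 _ 2 r.+1; rewrite ler1n => /(_ isT hr).
  by rewrite -/A expr2; lra.
have A1 : A - 1 != 0 by rewrite gt_eqF//; lra.
have QE : Q = A * pi by [].
have alA : 2 * al * A = Q + 2 * al by rewrite /al /Q; field.
have sE : s = (Num.sqrt 2)^-1 by [].
have AE : A = 2 ^+ r.+1 by [].
clearbody A Q al s.
have [pi0 Qge alge alle] := geometry A4 QE alA.
have Fg0 : is_fourier psi (fun x => (profile Q al s x)%:C).
  apply: (is_fourier_ae hpsi); first by apply: L2_meas; exact: L2_profile.
  have := ae_notin_countable (N := [set` endpoints Q al]) (finite_set_countable (finite_seq _)).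
  by apply: aeS => x /= /negP; exact: (psi_hat_profile A4 QE alA sE AE).
apply: (wavelet_from_fourier Fg0).
- by move=> x x0; case: (profileP s A4 QE alA x) => // h; exfalso; lra.
- by move=> i i'; exact: (dot_wavelet_hat A4 QE alA sE AE).
- by move=> f; exact: (wavelet_hat_span A4 QE alA sE AE).
Qed.
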